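(* Let $d\ge 1$ and let $(X_N)_{N\in\mathbb{N}}$ be a sequence of point sets $X_N=\{\mathbf{x}_1^{(N)},\ldots,\mathbf{x}_N^{(N)}\}\subset\mathbb{S}^d$ with $\#X_N=N$, which is hyperuniform for large caps. Then for all integers $n\geq 1$ $$\lim_{N\to\infty}\frac1N\sum_{i,j=1}^N P_n^{(d)}\bigl(\langle\mathbf{x}_i^{(N)},\mathbf{x}_j^{(N)}\rangle\bigr)=0.$$ As a consequence, every sequence $(X_N)_{N\in\mathbb{N}}$ of such point sets which is hyperuniform for large caps is uniformly distributed on $\mathbb{S}^d$.
   Context: $\mathbb{S}^d\subset\mathbb{R}^{d+1}$ is the unit sphere, $\langle\cdot,\cdot\rangle$ the Euclidean inner product, and $\sigma$ the normalised ($\sigma(\mathbb{S}^d)=1$) surface area measure on $\mathbb{S}^d$. For $\mathbf{x}\in\mathbb{S}^d$ and $\phi\in[0,\pi]$, the spherical cap is $C(\mathbf{x},\phi)=\{\mathbf{y}\in\mathbb{S}^d : \langle\mathbf{x},\mathbf{y}\rangle>\cos\phi\}$; its measure $\sigma(C(\cdot,\phi))$ does not depend on the centre. $P_n^{(d)}$ denotes the $n$-th generalised Legendre polynomial for $\mathbb{S}^d$: the polynomials of degree $n$ orthogonal on $[-1,1]$ with respect to the weight $(1-x^2)^{\frac{d-2}{2}}$, normalised by $P_n^{(d)}(1)=1$ (for $d\ge2$, proportional to the Gegenbauer polynomial $C_n^{\lambda}$ with $\lambda=\frac{d-1}{2}$). Number variance: for an $N$-point set $X_N\subset\mathbb{S}^d$,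 $$V(X_N,\phi)=\int_{\mathbb{S}^d}\bigl(\#(X_N\cap C(\mathbf{x},\phi))-N\sigma(C(\cdot,\phi))\bigr)^2\,\mathrm{d}\sigma(\mathbf{x}).$$ Hyperuniform for large caps: for every fixed $\phi\in(0,\frac{\pi}{2})$, $V(X_N,\phi)=o(N)$ as $N\to\infty$. Uniformly distributed on $\mathbb{S}^d$: for all $\mathbf{x}\in\mathbb{S}^d$ and $\phi\in[0,\pi]$, $\lim_{N\to\infty}\frac1N\#(X_N\cap C(\mathbf{x},\phi))=\sigma(C(\mathbf{x},\phi))$. *)

(* Defs.v *)
From HB Require Import structures.
From mathcomp Require Import all_boot all_order all_algebra.
From mathcomp Require Import all_classical all_reals all_analysis.
From mathcomp Require Import measurable_realfun.

Set Implicit Arguments.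
Unset Strict Implicit.
Unset Printing Implicit Defensive.
Import Order.TTheory GRing.Theory Num.Theory.
Import numFieldNormedType.Exports.
Local Open Scope classical_set_scope.
Local Open Scope ring_scope.

Section euclidean.
Context {R : realType}.

Definition dotp n (x y : n.-tuple R) : R := \sum_(i < n) tnth x i * tnth y i.

Definition enorm n (x : n.-tuple R) : R := Num.sqrt (dotp x x).

Definition sphere d : set (d.+1.-tuple R) := [set x | enorm x = 1].
Arguments sphere : clear implicits.

Definition cap d (x : d.+1.-tuple R) (phi : R) : set (d.+1.-tuple R) :=
  [set y | sphere d y /\ cos phi < dotp x y].

Definition unit_ball n : set (n.-tuple R) := [set x | enorm x <= 1].
Arguments unit_ball : clear implicits.

Definition normalize n (x : n.-tuple R) : n.-tuple R :=
  [tuple (enorm x)^-1 * tnth x i | i < n].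

(* The cone { t y | 0 < t <= 1, y in A } over a subset A of the unit sphere. *)
Definition cone n (A : set (n.-tuple R)) : set (n.-tuple R) :=
  [set x | 0 < enorm x <= 1 /\ A (normalize x)].

End euclidean.
Arguments sphere {R} d.
Arguments unit_ball {R} n.

Section lebesgue_tuple.
Context {R : realType}.

Definition tuple_cons n (p : measurableTypeR R * n.-tuple R) : n.+1.-tuple R :=
  [tuple of p.1 :: p.2].

Lemma measurable_tuple_cons n : measurable_fun setT (@tuple_cons n).
Proof.
apply: measurable_cons; last exact: measurable_snd.
move=> _ Y mY; exact: (@measurable_fst _ _ (measurableTypeR R) (n.-tuple R)).
Qed.

Section cons.
Variables (n : nat) (m : {sigma_finite_measure set (n.-tuple R) -> \bar R}).

Definition lebesgue_cons (A : set (n.+1.-tuple R)) : \bar R :=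
  (@lebesgue_measure R \x m)%E (@tuple_cons n @^-1` A).

Let mtuple_cons A : measurable A -> measurable (@tuple_cons n @^-1` A).
Proof. by move=> mA; rewrite -[X in measurable X]setTI; exact: measurable_tuple_cons. Qed.

Let lebesgue_cons0 : lebesgue_cons set0 = 0%E.
Proof. by rewrite /lebesgue_cons preimage_set0 measure0. Qed.

Let lebesgue_cons_ge0 A : (0 <= lebesgue_cons A)%E.
Proof. exact: measure_ge0. Qed.

Let lebesgue_cons_sigma_additive : semi_sigma_additive lebesgue_cons.
Proof.
move=> F mF tF mUF; rewrite /lebesgue_cons preimage_bigcup.
apply: measure_semi_sigma_additive.
- by move=> k; exact: mtuple_cons.
- apply/trivIsetP => /= i j _ _ ij; rewrite -preimage_setI.
  by move/trivIsetP : tF => /(_ _ _ _ _ ij) ->//; rewrite preimage_set0.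
- by rewrite -preimage_bigcup; exact: mtuple_cons.
Qed.

HB.instance Definition _ := isMeasure.Build _ _ _ lebesgue_cons
  lebesgue_cons0 lebesgue_cons_ge0 lebesgue_cons_sigma_additive.

Let lebesgue_cons_sigma_finite : sigma_finite setT lebesgue_cons.
Proof.
have /sigma_finiteP[F [TF ndF Foo]] := sigma_finiteT (@lebesgue_measure R).
have /sigma_finiteP[G [TG ndG Goo]] := sigma_finiteT m.
pose H k := [set t : n.+1.-tuple R | F k (thead t) /\ G k [tuple of behead t]].
exists H.
  apply/seteqP; split=> // t _.
  have [i _ Fi] : (\bigcup_i F i) (thead t) by rewrite -TF.
  have [j _ Gj] : (\bigcup_i G i) [tuple of behead t] by rewrite -TG.
  exists (maxn i j) => //; split.
    by move: Fi; exact/subsetPset/ndF/leq_maxl.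
  by move: Gj; exact/subsetPset/ndG/leq_maxr.
move=> k; have [mF ooF] := Foo k; have [mG ooG] := Goo k; split.
  apply: measurableI; rewrite -[X in measurable X]setTI.
    exact: measurable_tnth.
  exact: measurable_behead.
rewrite /lebesgue_cons (_ : _ @^-1` _ = F k `*` G k).
  by rewrite product_measure1E// lte_mul_pinfty// ge0_fin_numE.
apply/seteqP; split=> -[a t]; rewrite /H /= theadE.
  by move=> [Fa Gt]; split=> //; congr (G k _): Gt; exact: val_inj.
by move=> [Fa Gt]; split=> //; congr (G k _): Gt; exact: val_inj.
Qed.

HB.instance Definition _ := Measure_isSigmaFinite.Build _ _ _
  lebesgue_cons lebesgue_cons_sigma_finite.

End cons.

(* Lebesgue measure on R^n, as the n-fold product of the one on R. *)
Fixpoint lebesgue_tuple n : {sigma_finite_measure set (n.-tuple R) -> \bar R} :=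
  match n with
  | 0 => \d_([tuple] : 0.-tuple R)
  | k.+1 => lebesgue_cons (lebesgue_tuple k)
  end.

End lebesgue_tuple.

Section surface_measure.
Context {R : realType}.

Lemma measurable_dotp n : measurable_fun setT (fun x : n.-tuple R => dotp x x).
Proof.
apply: measurable_sum => i.
by apply: measurable_funM; exact: measurable_tnth.
Qed.

Lemma measurable_enorm n : measurable_fun setT (@enorm R n).
Proof.
apply: (@measurableT_comp _ _ _ _ _ _ (@Num.sqrt R)); last exact: measurable_dotp.
by apply: continuous_measurable_fun; exact: sqrt_continuous.
Qed.

Lemma measurable_normalize n : measurable_fun setT (@normalize R n).
Proof.
apply/measurable_fun_tnthP => i.
rewrite (_ : _ \o _ = fun x => (enorm x)^-1 * tnth x i).
  apply: measurable_funM; last exact: measurable_tnth.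
  rewrite (_ : (fun x => _) = (@powR R ^~ (-1)) \o @enorm R n).
    exact: measurableT_comp (measurable_powR _) (@measurable_enorm n).
  by apply/funext => x /=; rewrite powR_inv1// sqrtr_ge0.
by apply/funext => x /=; rewrite tnth_mktuple.
Qed.

Lemma measurable_cone n (A : set (n.-tuple R)) :
  measurable A -> measurable (cone A).
Proof.
move=> mA.
rewrite (_ : cone A = @enorm R n @^-1` `]0, 1] `&` @normalize R n @^-1` A).
  apply: measurableI; rewrite -[X in measurable X]setTI.
    exact: measurable_enorm.
  exact: measurable_normalize.
by apply/seteqP; split => x; rewrite /= in_itv.
Qed.

Lemma measurable_unit_ball n : measurable (unit_ball n : set (n.-tuple R)).
Proof.
rewrite -[X in measurable X]setTI (_ : unit_ball n = @enorm R n @^-1` `]-oo, 1]).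
  exact: measurable_enorm.
by apply/seteqP; split => x /=; rewrite in_itv.
Qed.

Lemma measurable_sphere d : measurable (sphere d : set (d.+1.-tuple R)).
Proof.
rewrite -[X in measurable X]setTI (_ : sphere d = @enorm R _ @^-1` [set 1])//.
exact: measurable_enorm.
Qed.


Lemma measurable_box n (I : interval R) :
  measurable [set x : n.-tuple R | forall i, tnth x i \in I].
Proof.
rewrite (_ : [set x | _] =
    \bigcap_(i in [set: 'I_n]) ((fun x => tnth x i) @^-1` [set` I])).
  apply: fin_bigcap_measurable => // i _.
  by rewrite -[X in measurable X]setTI; apply: measurable_tnth.
by apply/seteqP; split=> x /= h i; [move=> _|]; exact: h.
Qed.

Lemma lebesgue_tuple_box n (I : interval R) :
  lebesgue_tuple n [set x | forall i, tnth x i \in I] = (lebesgue_measure [set` I] ^+ n)%E.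
Proof.
elim: n => [|n IH].
  by rewrite /= diracE mem_set//; case.
rewrite expeS -{}IH /= /lebesgue_cons.
rewrite (_ : _ @^-1` _ = [set` I] `*` [set x | forall i, tnth x i \in I]).
  rewrite product_measure1E//.
  exact: measurable_box.
apply/seteqP; split=> -[a t] /=.
  move=> h; split; first by have := h ord0; rewrite tnth0.
  by move=> i; have := h (lift ord0 i); rewrite tnthS; congr (tnth _ _ \in _); exact: val_inj.
move=> [aI tI] i.
case: (unliftP ord0 i) => [j ->|->]; last by rewrite tnth0.
by rewrite tnthS; have := tI j; congr (tnth _ _ \in _); exact: val_inj.
Qed.

Lemma dotp_ge0 n (x : n.-tuple R) : 0 <= dotp x x.
Proof. by apply: sumr_ge0 => i _; rewrite -expr2 sqr_ge0. Qed.

Lemma enorm_eq0 n (x : n.-tuple R) : (enorm x == 0) = (dotp x x == 0).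
Proof.
by rewrite /enorm sqrtr_eq0 [RHS]eq_le dotp_ge0 andbT.
Qed.

Lemma tnth_le_enorm n (x : n.-tuple R) i : `|tnth x i| <= enorm x.
Proof.
rewrite -sqrtr_sqr ler_wsqrtr// /dotp (bigD1 i)//= expr2 lerDl.
by apply: sumr_ge0 => j _; rewrite -expr2 sqr_ge0.
Qed.

Lemma enorm_normalize n (x : n.-tuple R) : enorm x != 0 -> enorm (normalize x) = 1.
Proof.
move=> x0; rewrite /enorm /dotp.
under eq_bigr do rewrite !tnth_mktuple mulrACA.
rewrite -mulr_sumr -expr2 sqrtrM ?sqr_ge0// sqrtr_sqr ger0_norm ?invr_ge0 ?sqrtr_ge0//.
by rewrite mulVf.
Qed.

Lemma unit_ball_gt0 n : (0 < lebesgue_tuple n (@unit_ball R n))%E.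
Proof.
pose e : R := n.+1%:R^-1.
have e0 : 0 < e by rewrite invr_gt0.
apply: (@lt_le_trans _ _ (lebesgue_tuple n [set x | forall i, tnth x i \in `[- e, e]])).
  rewrite lebesgue_tuple_box lebesgue_measure_itv/= lte_fin gtrN// -EFinD -EFin_expe.
  by rewrite lte_fin exprn_gt0// opprK addr_gt0.
apply: le_measure; rewrite ?inE.
- exact: measurable_box.
- exact: measurable_unit_ball.
- move=> x /= h; rewrite /unit_ball/= /enorm -sqrtr1 ler_wsqrtr//.
  apply: (@le_trans _ _ (\sum_(i < n) e)).
    apply: ler_sum => i _; rewrite -expr2 -real_normK ?num_real//.
    have {}h : `|tnth x i| <= e by rewrite ler_norml; have := h i; rewrite in_itv.
    have e1 : e <= 1 by rewrite invf_le1// ler1n.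
    rewrite (le_trans _ h)// expr2 ler_piMl// (le_trans h)//.
  by rewrite sumr_const card_ord -mulr_natl ler_pdivrMr// mul1r ler_nat.
Qed.

Lemma unit_ball_lty n : (lebesgue_tuple n (@unit_ball R n) < +oo)%E.
Proof.
apply: (@le_lt_trans _ _ (lebesgue_tuple n [set x | forall i, tnth x i \in `[- 1, 1]])).
  apply: le_measure; rewrite ?inE.
  - exact: measurable_unit_ball.
  - exact: measurable_box.
  - move=> x /= h i; rewrite in_itv/= -ler_norml.
    exact: le_trans (tnth_le_enorm _ _) h.
rewrite lebesgue_tuple_box lebesgue_measure_itv/= lte_fin gtrN// -EFinD -EFin_expe.
exact: ltry.
Qed.

(* Normalised surface area measure of the unit sphere, as a Borel measure on
   R^(d+1) carried by the sphere: surface area is the radial part of Lebesgue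
   measure in polar coordinates (dx = r^d dr dS), so the area of a subset A of
   the sphere is d+1 times the volume of the cone over A, and the normalised
   area is the fraction of the volume of the unit ball lying in that cone. *)
Definition surface d (A : set (d.+1.-tuple R)) : \bar R :=
  (((fine (lebesgue_tuple d.+1 (@unit_ball R d.+1)))^-1)%:E
   * lebesgue_tuple d.+1 (cone A))%E.

Lemma lebesgue_cone_sphere d :
  lebesgue_tuple d.+1 (cone (sphere d)) = lebesgue_tuple d.+1 (@unit_ball R d.+1).
Proof.
have Z : lebesgue_tuple d.+1 (@enorm R d.+1 @^-1` [set 0]) = 0.
  apply/eqP; rewrite eq_le measure_ge0 andbT.
  apply: (@le_trans _ _ (lebesgue_tuple d.+1 [set x : d.+1.-tuple R | forall i, tnth x i \in `[0 : R, 0]])).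
    apply: le_measure; rewrite ?inE.
    - by rewrite -[X in measurable X]setTI; exact: measurable_enorm.
    - exact: measurable_box.
    - move=> x /= h i; rewrite in_itv/= -eq_le eq_sym -normr_le0 -h.
      exact: tnth_le_enorm.
  by rewrite lebesgue_tuple_box expeS lebesgue_measure_itv/= ltxx mul0e.
rewrite (_ : unit_ball d.+1 = cone (sphere d) `|` @enorm R d.+1 @^-1` [set 0]).
  rewrite measureU//=.
  - by rewrite Z adde0.
  - apply: measurable_cone; exact: measurable_sphere.
  - by rewrite -[X in measurable X]setTI; exact: measurable_enorm.
  - by apply/seteqP; split=> x //= -[[/andP[+ _] _] h]; rewrite h ltxx.
apply/seteqP; split => x /=; rewrite /unit_ball /cone/=.
  move=> x1; have [x0|x0] := eqVneq (enorm x) 0; first by right.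
  left; split; last exact: enorm_normalize.
  by rewrite x1 andbT lt_neqAle eq_sym x0 sqrtr_ge0.
by move=> [[/andP[]]//|->]; exact: ler01.
Qed.

Let surface0 d : surface (set0 : set (d.+1.-tuple R)) = 0%E.
Proof.
rewrite /surface (_ : cone set0 = set0) ?measure0 ?mule0//.
by apply/seteqP; split=> x // [].
Qed.

Let surface_ge0 d (A : set (d.+1.-tuple R)) : (0 <= surface A)%E.
Proof. by apply: mule_ge0 => //; rewrite lee_fin invr_ge0 fine_ge0. Qed.

Let surface_sigma_additive d : semi_sigma_additive (@surface d).
Proof.
move=> F mF tF mUF; rewrite /surface.
rewrite [X in X @ \oo --> _](_ : _ = (fun n =>
  ((fine (lebesgue_tuple d.+1 (@unit_ball R d.+1)))^-1)%:E *
  \sum_(0 <= i < n) lebesgue_tuple d.+1 (cone (F i)))%E); last first.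
  by apply/funext => n; rewrite ge0_sume_distrr.
rewrite (_ : cone _ = \bigcup_n cone (F n)).
  apply: cvgeZl => //; apply: measure_semi_sigma_additive.
  - by move=> i; exact: measurable_cone.
  - apply/trivIsetP => i j _ _ ij; apply/seteqP; split=> x // -[[_ xi] [_ xj]].
    by move/trivIsetP : tF => /(_ i j I I ij)/seteqP[+ _] => /(_ (normalize x)); apply; split.
  - by apply: bigcup_measurable => i _; exact: measurable_cone.
apply/seteqP; split=> x; first by move=> [x1 [i _ Fi]]; exists i.
by move=> [i _ [x1 Fi]]; split=> //; exists i.
Qed.

HB.instance Definition _ d := isMeasure.Build _ _ _ (@surface d)
  (surface0 d) (@surface_ge0 d) (@surface_sigma_additive d).

Lemma surface_sphere d : surface (sphere d) = 1%E.
Proof.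
rewrite /surface lebesgue_cone_sphere.
rewrite -[X in (_ * X)%E]fineK; last by rewrite ge0_fin_numE// unit_ball_lty.
rewrite -EFinM mulVf// gt_eqF// fine_gt0//.
by rewrite unit_ball_gt0 unit_ball_lty.
Qed.

Let surface_setT d : surface ([set: d.+1.-tuple R]) = 1%E.
Proof.
rewrite -(surface_sphere d) /surface; congr (_ * lebesgue_tuple _ _)%E.
apply/seteqP; split=> x [/andP[x0 x1] _]; split=> //; rewrite ?x0//.
by apply: enorm_normalize; rewrite gt_eqF.
Qed.

HB.instance Definition _ d :=
  Measure_isProbability.Build _ _ _ (@surface d) (@surface_setT d).

End surface_measure.

Section point_sets.
Context {R : realType}.

(* An N-point set is given by an enumeration X : 'I_N -> R^(d+1), to be assumed
   injective and with values in the sphere; [npoints X A] is #(X n A). *)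
Definition npoints d N (X : 'I_N -> d.+1.-tuple R) (A : set (d.+1.-tuple R)) :
  nat := #|[pred i | X i \in A]|.

Definition number_variance d N (X : 'I_N -> d.+1.-tuple R) (phi : R) : R :=
  \int[@surface R d]_(x in sphere d)
    ((npoints X (cap x phi))%:R - N%:R * fine (surface (cap x phi))) ^+ 2.

Definition hyperuniform_large_caps d (X : forall N, 'I_N -> d.+1.-tuple R) :=
  forall phi : R, 0 < phi < pi / 2 ->
    (fun N => number_variance (X N) phi) =o_\oo (fun N => N%:R : R).

Definition uniformly_distributed d (X : forall N, 'I_N -> d.+1.-tuple R) :=
  forall (x : d.+1.-tuple R) (phi : R), sphere d x -> 0 <= phi <= pi ->
    (fun N => N%:R^-1 * (npoints (X N) (cap x phi))%:R : R) @ \oo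
      --> fine (surface (cap x phi)).

End point_sets.

(* The value of the weight at the endpoints -1 and 1 (singular for d = 1) is
   irrelevant to the integral. *)
Definition legendre_weight (R : realType) (d : nat) (x : R) : R :=
  (1 - x ^+ 2) `^ ((d%:R - 2) / 2).

(* P is the sequence of generalised Legendre polynomials for the d-sphere. *)
Definition generalised_legendre (R : realType) (d : nat) (P : nat -> {poly R}) :=
  [/\ forall n, size (P n) = n.+1,
      forall m n, m <> n ->
        (\int[@lebesgue_measure R]_(x in `[(-1)%R, 1%R])
           ((P m).[x] * (P n).[x] * legendre_weight d x)%:E = 0)%E &
      forall n, (P n).[1] = 1].

(* Main.v *)
(* Write [E] for the mean over the sphere, [F] for the discrepancy
   [y |-> #(X_N /\ C(y, phi)) - N sigma(C(., phi))], so that [V = E F^2], and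
   [a = E 1_(t > cos phi) P_n(t)] with [t = <e0, y>].
   Rotation invariance of the surface measure (proved for reflections, from
   shears of Lebesgue measure) and the coincidence, up to a factor, of the moments of
   [t] with those of the weight [(1 - t^2)^((d - 2) / 2)] yield the Funk-Hecke formula
   [E_y f(<x, y>) P_n(<z, y>) = (E f(t) P_n(t)) P_n(<x, z>)].
   For [f = 1_(t > cos phi)] and [s(z) = sum_i P_n(<x_i, z>)] it gives
   [a s(z) = E_y F(y) P_n(<z, y>)], hence [a^2 s(z)^2 <= V E P_n(t)^2] by Cauchy-Schwarz;
   for [f = P_n] it gives [E s^2 = E P_n(t)^2 sum_(i, j) P_n(<x_i, x_j>)].
   Thus [0 <= a^2 sum_(i, j) P_n(<x_i, x_j>) <= V = o(N)], and [a <> 0] for small [phi]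
   since [P_n(1) = 1].
   For uniform distribution, the integrals of [F] over caps slightly larger and slightly
   smaller than a given cap are [o(N)] too, and they enclose the number of points in
   that cap. *)
Require Import Defs.
From mathcomp Require Import all_boot all_order all_algebra.
From mathcomp Require Import all_classical all_reals all_analysis.
From mathcomp Require Import measurable_realfun ring lra.
Import Order.TTheory GRing.Theory Num.Theory.
Import numFieldNormedType.Exports.
Set Implicit Arguments.
Unset Strict Implicit.
Unset Printing Implicit Defensive.
Local Open Scope classical_set_scope.
Local Open Scope ring_scope.

(** * Householder reflections preserve Lebesgue measure *)

Section linear_maps.
Context {R : realType}.

(** The surface measure is defined through volumes of cones, and Lebesgue measure on tuples is an
    iterated product, so the proof avoids both polar coordinates and the rotation group. Symmetry:
    two reflections carry any pair of points of the sphere to any other pair with the same inner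
    product, so invariance under reflections suffices, and this reduces to affine maps in one
    coordinate and Fubini. Distribution of [t]: the Legendre hypothesis only involves integrals of
    polynomials, so comparing moments suffices. On both sides [(k + 1) M_k = (k + 1 + d) M_(k + 2)]
    and odd moments vanish; on the sphere this comes from symmetry, for the weight from integrating
    an exact derivative. The factor [a] may vanish for a particular [phi]; hyperuniformity at every
    small [phi] allows a choice depending on [n]. Only the test caps must have radius below
    [pi / 2], so uniform distribution is reached for target caps of every radius. *)

Definition axpy n (c : R) (w t : n.-tuple R) : n.-tuple R :=
  [tuple tnth t i + c * tnth w i | i < n].

(* The reflection along [v]; it is the identity for [v = 0] because [_ / 0 = 0]. *)
Definition mirror n (v x : n.-tuple R) : n.-tuple R :=
  axpy (- (2 * dotp x v / dotp v v)) v x.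

Lemma tnth_axpy n c (w t : n.-tuple R) i :
  tnth (axpy c w t) i = tnth t i + c * tnth w i.
Proof. by rewrite tnth_mktuple. Qed.

Lemma dotpC n (x y : n.-tuple R) : dotp x y = dotp y x.
Proof. by apply: eq_bigr => i _; rewrite mulrC. Qed.

Lemma dotp_axpy n c (w t y : n.-tuple R) :
  dotp (axpy c w t) y = dotp t y + c * dotp w y.
Proof.
rewrite /dotp mulr_sumr -big_split/=; apply: eq_bigr => i _.
by rewrite tnth_axpy mulrDl mulrA.
Qed.

Lemma dotp_eq0 n (v : n.-tuple R) : dotp v v = 0 -> forall i, tnth v i = 0.
Proof.
move=> /eqP; rewrite psumr_eq0; last by move=> i _; rewrite -expr2 sqr_ge0.
by move=> /allP h i; have := h i (mem_index_enum i); rewrite /= mulf_eq0 orbb => /eqP.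
Qed.

Lemma dotp_mirror n (v x y : n.-tuple R) :
  dotp (mirror v x) (mirror v y) = dotp x y.
Proof.
rewrite /mirror dotp_axpy [dotp x _]dotpC [dotp v (axpy _ _ _)]dotpC !dotp_axpy.
rewrite [dotp y x]dotpC [dotp v x]dotpC.
have [v0|v0] := eqVneq (dotp v v) 0; last by field.
by rewrite v0 invr0 !mulr0 oppr0 !mul0r !addr0.
Qed.

Lemma mirror_perp n (v x : n.-tuple R) : dotp x v = 0 -> mirror v x = x.
Proof.
by move=> xv; apply/eq_from_tnth => i; rewrite tnth_axpy xv mulr0 mul0r oppr0 mul0r addr0.
Qed.

(** For vectors of equal length [|x - y|^2 = 2 <x, x - y>], so the reflection along [x - y]
    subtracts exactly [x - y] from [x]. If [x = y] it is the identity. *)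
Lemma mirror_swap n (x y : n.-tuple R) :
  dotp x x = dotp y y -> mirror (axpy (-1) y x) x = y.
Proof.
move=> xy; set v := axpy _ _ _.
have vv : dotp v v = 2 * dotp x v.
  rewrite {2}/v /v dotp_axpy [dotp x (axpy _ _ _)]dotpC dotp_axpy.
  rewrite [dotp y (axpy _ _ _)]dotpC dotp_axpy [dotp y x]dotpC -xy; ring.
apply/eq_from_tnth => i; rewrite tnth_axpy -vv.
have [v0|v0] := eqVneq (dotp v v) 0.
  rewrite (dotp_eq0 v0) mulr0 addr0; have := dotp_eq0 v0 i.
  by rewrite tnth_axpy mulN1r => /eqP; rewrite subr_eq0 => /eqP.
by rewrite divff// tnth_axpy; ring.
Qed.

Lemma dotp_cons n (p q : R * n.-tuple R) :
  dotp (tuple_cons p) (tuple_cons q) = p.1 * q.1 + dotp p.2 q.2.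
Proof.
rewrite /dotp big_ord_recl !tnth0; congr (_ + _).
by apply: eq_bigr => i _; rewrite !tnthS; congr (_ * _); congr tnth; exact: val_inj.
Qed.

Lemma axpy_cons n c (p q : R * n.-tuple R) :
  axpy c (tuple_cons p) (tuple_cons q) = tuple_cons (q.1 + c * p.1, axpy c p.2 q.2).
Proof.
apply/eq_from_tnth => i; rewrite tnth_axpy.
case: (unliftP ord0 i) => [j ->|->]; last by rewrite !tnth0.
by rewrite !tnthS tnth_axpy.
Qed.

Lemma tuple_consP n (v : n.+1.-tuple R) : exists p : R * n.-tuple R, v = tuple_cons p.
Proof.
exists (thead v, [tuple of behead v]); rewrite {1}(tuple_eta v).
by apply: val_inj.
Qed.

Lemma measurable_axpy d (T : measurableType d) n (w : n.-tuple R) (c : T -> R)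
    (f : T -> n.-tuple R) :
  measurable_fun setT c -> measurable_fun setT f ->
  measurable_fun setT (fun x => axpy (c x) w (f x)).
Proof.
move=> mc mf; apply/measurable_fun_tnthP => i.
rewrite (_ : _ \o _ = (fun x => tnth (f x) i + c x * tnth w i)); last first.
  by apply/funext => x /=; rewrite tnth_axpy.
apply: measurable_funD; last exact: measurable_funM.
exact: (measurableT_comp (measurable_tnth i) mf).
Qed.

Lemma measurable_dotpl d (T : measurableType d) n (f g : T -> n.-tuple R) :
  measurable_fun setT f -> measurable_fun setT g ->
  measurable_fun setT (fun x => dotp (f x) (g x)).
Proof.
move=> mf mg; apply: measurable_sum => i.
apply: measurable_funM.
  exact: (measurableT_comp (measurable_tnth i) mf).
exact: (measurableT_comp (measurable_tnth i) mg).
Qed.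

Lemma measurable_mirror n (v : n.-tuple R) : measurable_fun setT (mirror v).
Proof.
apply: (@measurable_axpy _ _ n v (fun x => - (2 * dotp x v / dotp v v)) id) => //.
apply: measurable_funN; apply: measurable_funM => //; apply: measurable_funM => //.
exact: measurable_dotpl.
Qed.

End linear_maps.

Lemma measurable_preimage d d' (T : measurableType d) (U : measurableType d')
    (f : T -> U) (A : set U) :
  measurable_fun setT f -> measurable A -> measurable (f @^-1` A).
Proof. by move=> mf mA; rewrite -[X in measurable X]setTI; exact: mf. Qed.

Section lebesgue_invariance.
Context {R : realType}.
Local Notation mu := (@lebesgue_measure R).

Lemma lebesgue_affine (c b : R) (A : set (measurableTypeR R)) :
  c != 0 -> measurable A ->
  mu ((fun x => c * x + b) @^-1` A) = ((`|c|^-1)%:E * mu A)%E.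
Proof.
move=> c0 mA; set f := fun x => _.
have mf : measurable_fun setT (f : measurableTypeR R -> measurableTypeR R).
  by apply: measurable_funD => //; exact: measurable_funM.
pose nu := measure_function_pushforward__canonical__measure_function_Measure mu mf.
have cge0 : 0 <= `|c| by [].
(* The pushforward scaled by [|c|] is compared with [mu] on half-open intervals only. For [c < 0]
   the preimage is closed on the other side, with the same length. *)
rewrite (@lebesgue_measure_unique R (mscale (NngNum cge0) nu) _ A)//; last first.
  move=> X /ocitvP[->|[[a a'] /= aa' ->]]; first by rewrite !measure0.
  rewrite /mscale/= /pushforward.
  have [c_gt0|c_lt0|/eqP] := ltgtP 0 c; last by rewrite eq_sym (negbTE c0).
    rewrite (_ : f @^-1` _ = `](a - b) / c, (a' - b) / c]%classic); last first.
      apply/seteqP; split => x; rewrite /= /f !in_itv/= ltr_pdivrMr// ler_pdivlMr//;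
        by rewrite ltrBlDr lerBrDr mulrC.
    rewrite !lebesgue_measure_itv/= !lte_fin aa' ltr_pM2r ?invr_gt0// ltrD2r aa'.
    by rewrite -!EFinD -EFinM gtr0_norm//; congr EFin; field.
  rewrite (_ : f @^-1` _ = `[(a' - b) / c, (a - b) / c[%classic); last first.
    apply/seteqP; split => x; rewrite /= /f !in_itv/= ler_ndivrMr// ltr_ndivlMr//;
      by rewrite ltrBlDr lerBrDr mulrC andbC.
  rewrite !lebesgue_measure_itv/= !lte_fin aa' ltr_nM2r ?invr_lt0// ltrD2r aa'.
  by rewrite -!EFinD -EFinM ltr0_norm//; congr EFin; field.
by rewrite /mscale/= muleA -EFinM mulVf ?normr_eq0// mul1e.
Qed.

Section product.
Variable n : nat.
Local Notation L := (lebesgue_tuple (R:=R) n).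
Local Notation P := (mu \x L)%E.

(** The product measure integrates the measures of the sections over the first coordinate, and each
    section keeps its measure. *)
Lemma product_tail_invariant (psi : R -> n.-tuple R -> n.-tuple R)
    (A : set (measurableTypeR R * n.-tuple R)) :
  (forall x B, measurable B -> L (psi x @^-1` B) = L B) -> measurable A ->
  P ((fun p => (p.1, psi p.1 p.2)) @^-1` A) = P A.
Proof.
move=> Lpsi mA; apply: eq_integral => x _ /=.
rewrite -[RHS](Lpsi x)//; last exact: measurable_xsection.
Qed.

Lemma product_head_affine (a : R) (h : n.-tuple R -> R)
    (A : set (measurableTypeR R * n.-tuple R)) :
  a != 0 -> measurable_fun setT h -> measurable A ->
  P ((fun p => (a * p.1 + h p.2, p.2)) @^-1` A) = ((`|a|^-1)%:E * P A)%E.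
Proof.
move=> a0 mh mA.
(* The map is affine in the first coordinate for a fixed tail, so the product is integrated in the
   other order, over sections with fixed tail. *)
have PE B : measurable B -> P B = (mu \x^ L)%E B.
  by apply: (@product_measure_unique _ _ _ _ _ mu L (mu \x^ L)%E) => C D mC mD /=;
    rewrite product_measure2E.
rewrite !PE//; last first.
  rewrite -[X in measurable X]setTI.
  apply: (measurable_fun_pair (T := (measurableTypeR R * n.-tuple R)%type)
    (T1 := measurableTypeR R) (T2 := n.-tuple R)) => //.
  apply: measurable_funD; last exact: measurableT_comp.
  by apply: measurable_funM => //; exact: measurable_fst.
rewrite /product_measure2 -ge0_integralZl//; last exact: measurable_fun_ysection.
apply: eq_integral => t _ /=.
rewrite -(@lebesgue_affine a (h t))//; last exact: measurable_ysection.
Qed.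

End product.

(** Serves the shear in [lebesgue_tuple_mirror], which translates the tail once the first coordinate
    is fixed. *)
Lemma lebesgue_tuple_translate n c (w : n.-tuple R) A : measurable A ->
  lebesgue_tuple n (axpy c w @^-1` A) = lebesgue_tuple n A.
Proof.
elim: n w A => [|n IH] w A mA.
  congr (_ _); apply/seteqP; split => t /=; by rewrite [axpy _ _ _]tuple0 [t]tuple0.
have [[a u] ->] := tuple_consP w.
have mcA : measurable (@tuple_cons R n @^-1` A).
  by rewrite -[X in measurable X]setTI; exact: measurable_tuple_cons.
rewrite /= /lebesgue_cons.
rewrite -[RHS](@product_tail_invariant n (fun _ => axpy c u))//; last first.
  by move=> _; exact: IH.
set B := _ @^-1` (@tuple_cons R n @^-1` A).
have mB : measurable B.
  apply: measurable_preimage mcA.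
  apply: (measurable_fun_pair (T := (measurableTypeR R * n.-tuple R)%type)
    (T1 := measurableTypeR R) (T2 := n.-tuple R)).
    exact: measurable_fst.
  by apply: measurable_axpy => //; exact: measurable_snd.
rewrite -[RHS]mul1e -[in RHS]invr1 -[in RHS](@normr1 R).
rewrite -(@product_head_affine n 1 (fun=> c * a))// ?oner_neq0//.
congr ((_ \x _)%E _); apply/seteqP; split => -[x t]; rewrite /B /= axpy_cons/= mul1r//.
Qed.

(* If the first coordinate [a] of [v = (a, w)] is nonzero, the reflection along
   [v] is the composite of [(x, t) |-> (a x + <t, w>, t)], which replaces the first
   coordinate by [s = <x, v>], of the shear [(s, t) |-> (s, t - (2 s / <v, v>) w)],
   and of an affine map of the first coordinate; the two scaling factors cancel. *)
Lemma lebesgue_tuple_mirror n (v : n.-tuple R) A : measurable A ->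
  lebesgue_tuple n (mirror v @^-1` A) = lebesgue_tuple n A.
Proof.
elim: n v A => [|n IH] v A mA.
  congr (_ _); apply/seteqP; split => t /=; by rewrite [mirror _ _]tuple0 [t]tuple0.
have [[a w] ->] := tuple_consP v.
have mcA : measurable (@tuple_cons R n @^-1` A).
  by rewrite -[X in measurable X]setTI; exact: measurable_tuple_cons.
rewrite /= /lebesgue_cons; set A' := _ @^-1` A in mcA *.
(* With [a = 0] the first coordinate is fixed and the tail is reflected along [w], so induction
   applies. *)
have [->|a0] := eqVneq a 0.
  rewrite -[RHS](@product_tail_invariant n (fun _ => mirror w))//; last first.
    by move=> _; exact: IH.
  congr ((_ \x _)%E _); apply/seteqP; split => -[x t];
    by rewrite /A' /mirror /= axpy_cons/= !dotp_cons/= !mulr0 !add0r addr0.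
set q := dotp (tuple_cons (a, w)) (tuple_cons (a, w)).
have q0 : q != 0.
  by apply/eqP => /dotp_eq0/(_ ord0)/eqP; rewrite tnth0 (negbTE a0).
pose al (p : measurableTypeR R * n.-tuple R) : measurableTypeR R * n.-tuple R :=
  (a * p.1 + dotp p.2 w, p.2).
pose be (p : measurableTypeR R * n.-tuple R) : measurableTypeR R * n.-tuple R :=
  (p.1, axpy (- (2 * p.1 / q)) w p.2).
(* Reflection turns [s = <x, v>] into [- s]; hence the new first coordinate [x'] solves
   [a x' + <t', w> = - s], where [t'] is the sheared tail. *)
pose ga (p : measurableTypeR R * n.-tuple R) : measurableTypeR R * n.-tuple R :=
  (- a^-1 * p.1 + - a^-1 * dotp p.2 w, p.2).
have mirrorE p : mirror (tuple_cons (a, w)) (tuple_cons p) = tuple_cons (ga (be (al p))).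
  case: p => x t; rewrite /mirror -/q axpy_cons/= !dotp_cons/=.
  rewrite /ga /be /al /= dotp_axpy [a * x]mulrC; congr (tuple_cons (_, _)).
  have -> : dotp w w = q - a * a by rewrite /q dotp_cons/=; ring.
  by move: (dotp t w) => D; clearbody q; move: x => /= x;
    rewrite -[x]/(x : R); field; rewrite q0 a0.
have mdot : measurable_fun setT (fun t : n.-tuple R => dotp t w) by exact: measurable_dotpl.
have mga : measurable (ga @^-1` A').
  rewrite -[X in measurable X]setTI.
  apply: (measurable_fun_pair (T := (measurableTypeR R * n.-tuple R)%type)
    (T1 := measurableTypeR R) (T2 := n.-tuple R)) => //.
  apply: measurable_funD.
    by apply: measurable_funM => //; exact: measurable_fst.
  apply: measurable_funM => //.
  by apply: measurable_dotpl => //; exact: measurable_snd.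
have mbe : measurable (be @^-1` (ga @^-1` A')).
  rewrite -[X in measurable X]setTI.
  apply: (measurable_fun_pair (T := (measurableTypeR R * n.-tuple R)%type)
    (T1 := measurableTypeR R) (T2 := n.-tuple R)) => //.
  apply: measurable_axpy; last exact: measurable_snd.
  apply: measurable_funN; apply: measurable_funM => //.
  by apply: measurable_funM => //; exact: measurable_fst.
rewrite (_ : _ @^-1` _ = al @^-1` (be @^-1` (ga @^-1` A'))); last first.
  by apply/seteqP; split => p; rewrite /A' /= mirrorE.
rewrite (@product_head_affine n a (fun t => dotp t w))//.
rewrite (@product_tail_invariant n (fun x => axpy (- (2 * x / q)) w))//; last first.
  by move=> x B mB; exact: lebesgue_tuple_translate.
rewrite (@product_head_affine n (- a^-1) (fun t => - a^-1 * dotp t w)) ?oppr_eq0 ?invr_eq0//;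
  last exact: measurable_funM.
by rewrite muleA -EFinM normrN normrV ?unitfE// invrK mulVf ?normr_eq0// mul1e.
Qed.

Lemma surface_mirror d (v : d.+1.-tuple R) A : measurable A ->
  surface (mirror v @^-1` A) = surface A.
Proof.
move=> mA; rewrite /surface; congr (_ * _)%E.
rewrite -[RHS](lebesgue_tuple_mirror v); last exact: measurable_cone.
congr (lebesgue_tuple _ _); apply/seteqP.
have eE x : enorm (mirror v x) = enorm x by rewrite /enorm dotp_mirror.
have nE x : normalize (mirror v x) = mirror v (normalize x).
  have dE : dotp (normalize x) v = (enorm x)^-1 * dotp x v.
    by rewrite /dotp mulr_sumr; apply: eq_bigr => i _; rewrite tnth_mktuple mulrA.
  apply/eq_from_tnth => i; rewrite tnth_mktuple !tnth_axpy dE tnth_mktuple eE; ring.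
by split => x; rewrite /cone/= nE eE.
Qed.

End lebesgue_invariance.

(** * Averages over the sphere *)

Section mean.
Context {R : realType}.
Variable d : nat.
Local Notation T := (d.+1.-tuple R).
Local Notation S := (sphere d : set T).
Local Notation mu := (@surface R d).

Definition mean (f : T -> R) : R := \int[mu]_(y in S) f y.

(** The bound is asked for on the sphere only, since polynomials in [dotp x y] are unbounded off it.
    The class is an algebra of functions integrable on the sphere. *)
Definition bounded_measurable (f : T -> R) :=
  measurable_fun setT f /\ exists M, forall y, S y -> `|f y| <= M.

Lemma sphere_dotp (x : T) : S x <-> dotp x x = 1.
Proof.
split=> [x1|x1]; last by rewrite /sphere/= /enorm x1 sqrtr1.
by rewrite -(sqr_sqrtr (dotp_ge0 x)) -/(enorm x) x1 expr1n.
Qed.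

Lemma sphere_measurable : measurable S. Proof. exact: measurable_sphere. Qed.
Hint Resolve sphere_measurable : core.

Lemma surface_setT1 : mu setT = 1%E. Proof. exact: probability_setT. Qed.

Lemma bmf_integrable f : bounded_measurable f -> mu.-integrable S (EFin \o f).
Proof.
move=> [mf [M hM]].
apply: (@le_integrable _ _ _ mu S _ _ (EFin \o cst M)) => //.
- by apply/measurable_EFinP; exact: measurable_funTS.
- move=> x Sx /=; rewrite lee_fin (le_trans (hM _ Sx))// ler_norm//.
- exact: finite_measure_integrable_cst.
Qed.

Lemma eq_mean f g : (forall y, S y -> f y = g y) -> mean f = mean g.
Proof. by move=> fg; apply: eq_Rintegral => y /set_mem Sy; exact: fg. Qed.

Lemma bmf_cst c : bounded_measurable (fun=> c).
Proof. by split=> //; exists `|c|. Qed.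

Lemma bmfD f g :
  bounded_measurable f -> bounded_measurable g -> bounded_measurable (fun y => f y + g y).
Proof.
move=> [mf [M hM]] [mg [M' hM']]; split; first exact: measurable_funD.
by exists (M + M') => y Sy; rewrite (le_trans (ler_normD _ _))// lerD ?hM ?hM'.
Qed.

Lemma bmfM f g :
  bounded_measurable f -> bounded_measurable g -> bounded_measurable (fun y => f y * g y).
Proof.
move=> [mf [M hM]] [mg [M' hM']]; split; first exact: measurable_funM.
by exists (M * M') => y Sy; rewrite normrM ler_pM ?hM ?hM'.
Qed.

Lemma bmfZ c f : bounded_measurable f -> bounded_measurable (fun y => c * f y).
Proof. by move=> bf; apply: bmfM => //; exact: bmf_cst. Qed.

Lemma bmfB f g :
  bounded_measurable f -> bounded_measurable g -> bounded_measurable (fun y => f y - g y).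
Proof.
by move=> bf bg; have := bmfD bf (bmfZ (-1) bg); under eq_fun do rewrite mulN1r.
Qed.

Lemma bmf_sum (I : Type) (s : seq I) (F : I -> T -> R) :
  (forall i, bounded_measurable (F i)) -> bounded_measurable (fun y => \sum_(i <- s) F i y).
Proof.
move=> bF; elim: s => [|i s IH].
  by under eq_fun do rewrite big_nil; exact: bmf_cst.
by under eq_fun do rewrite big_cons; exact: bmfD.
Qed.

Lemma bmfX f n : bounded_measurable f -> bounded_measurable (fun y => f y ^+ n).
Proof.
move=> bf; elim: n => [|n IH].
  by under eq_fun do rewrite expr0; exact: bmf_cst.
by under eq_fun do rewrite exprS; exact: bmfM.
Qed.

Lemma dotp_le1 (x y : T) : S x -> S y -> `|dotp x y| <= 1.
Proof.
move=> /sphere_dotp x1 /sphere_dotp y1.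
(* This is [|x + c y|^2]; the values [c = 1] and [c = -1] give both inequalities. *)
have h c : 0 <= dotp x x + c * dotp y x + c * (dotp x y + c * dotp y y).
  have := dotp_ge0 (axpy c y x).
  by rewrite dotp_axpy [dotp x (axpy _ _ _)]dotpC [dotp y (axpy _ _ _)]dotpC !dotp_axpy.
rewrite ler_norml; have := h 1; have := h (-1); rewrite x1 y1 [dotp y x]dotpC; lra.
Qed.

Lemma bmf_dotp x : S x -> bounded_measurable (fun y => dotp x y).
Proof.
move=> Sx; split; first exact: measurable_dotpl.
by exists 1 => y Sy; exact: dotp_le1.
Qed.

Lemma bmf_indic (A : set T) : measurable A -> bounded_measurable (\1_A).
Proof.
move=> mA; split; first exact: measurable_indic.
by exists 1 => y _; rewrite indicE; case: (_ \in _); rewrite ?normr1 ?normr0.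
Qed.

Lemma measurable_fun_gt (c : R) d' (U : measurableType d') (f : U -> R) :
  measurable_fun setT f -> measurable_fun setT (fun y => (c < f y)%R%:R : R).
Proof.
move=> mf; rewrite (_ : (fun y => _) = \1_(f @^-1` `]c, +oo[)).
  by apply: measurable_indic; exact: measurable_preimage.
apply/funext => y; rewrite indicE /=; congr (nat_of_bool _)%:R.
by apply/idP/idP; rewrite inE/= in_itv/= andbT.
Qed.

Lemma bmf_gt (c : R) (f : T -> R) : measurable_fun setT f ->
  bounded_measurable (fun y => (c < f y)%R%:R).
Proof.
move=> mf; split; first exact: measurable_fun_gt.
by exists 1 => y _; case: (_ < _); rewrite ?normr1 ?normr0.
Qed.

Lemma mean_cst c : mean (fun=> c) = c.
Proof. by rewrite /mean Rintegral_cst//= surface_sphere mulr1. Qed.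

Lemma meanD f g : bounded_measurable f -> bounded_measurable g ->
  mean (fun y => f y + g y) = mean f + mean g.
Proof. by move=> bf bg; apply: RintegralD => //; exact: bmf_integrable. Qed.

Lemma meanZ c f : bounded_measurable f -> mean (fun y => c * f y) = c * mean f.
Proof. by move=> bf; apply: RintegralZl => //; exact: bmf_integrable. Qed.

Lemma meanZr c f : bounded_measurable f -> mean (fun y => f y * c) = mean f * c.
Proof. by move=> bf; apply: RintegralZr => //; exact: bmf_integrable. Qed.

Lemma meanB f g : bounded_measurable f -> bounded_measurable g ->
  mean (fun y => f y - g y) = mean f - mean g.
Proof. by move=> bf bg; apply: RintegralB => //; exact: bmf_integrable. Qed.

Lemma mean_sum (I : Type) (s : seq I) (F : I -> T -> R) :
  (forall i, bounded_measurable (F i)) ->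
  mean (fun y => \sum_(i <- s) F i y) = \sum_(i <- s) mean (F i).
Proof.
move=> bF; elim: s => [|i s IH].
  by under eq_fun do rewrite big_nil; rewrite mean_cst big_nil.
under eq_fun do rewrite big_cons.
by rewrite meanD// ?IH ?big_cons//; exact: bmf_sum.
Qed.

Lemma mean_ge0 f : (forall y, S y -> 0 <= f y) -> 0 <= mean f.
Proof. exact: Rintegral_ge0. Qed.

Lemma le_mean f g : bounded_measurable f -> bounded_measurable g -> (forall y, S y -> f y <= g y) ->
  mean f <= mean g.
Proof. by move=> bf bg fg; apply: le_Rintegral => //; exact: bmf_integrable. Qed.

Lemma mean_indic (A : set T) : measurable A ->
  mean (\1_A) = fine (mu (A `&` S)).
Proof. by move=> mA; rewrite /mean /Rintegral integral_indic. Qed.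

Lemma sphere_mirror (v x : T) : S (mirror v x) <-> S x.
Proof. by rewrite !sphere_dotp dotp_mirror. Qed.

Lemma mean_mirror (v : T) f : bounded_measurable f -> mean (f \o mirror v) = mean f.
Proof.
move=> bf; have [mf [M hM]] := bf.
have mr := measurable_mirror v.
have preS : mirror v @^-1` S = S by apply/seteqP; split=> x; rewrite /= sphere_mirror.
have bfr : bounded_measurable (f \o mirror v).
  split; first exact: measurableT_comp.
  by exists M => y Sy; apply: hM; apply/sphere_mirror.
pose nu := measure_function_pushforward__canonical__measure_function_Measure mu mr.
rewrite /mean /Rintegral; congr fine.
transitivity (\int[nu]_(y in S) (f y)%:E)%E; last first.
  by apply: eq_measure_integral => A mA _; exact: surface_mirror.
rewrite integral_pushforward// ?preS//.
- exact/measurable_EFinP.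
- exact: bmf_integrable.
Qed.

Lemma Fubini_mean (F : T -> T -> R) (M : R) :
  measurable_fun setT (fun p : T * T => F p.1 p.2) ->
  (forall x y, S x -> S y -> `|F x y| <= M) ->
  mean (fun x => mean (F x)) = mean (fun y => mean (F^~ y)).
Proof.
move=> mF hM.
(* [F] is controlled on pairs of sphere points only; the cut-off makes it integrable over the whole
   product, and [HF] below identifies both iterated means with iterated integrals of the cut-off
   function. *)
pose G (p : T * T) : R := F p.1 p.2 * \1_(S `*` S) p.
have mSS : measurable (S `*` S) by exact: measurableX.
have mG : measurable_fun setT G by apply: measurable_funM => //; exact: measurable_indic.
have iG : (mu \x mu)%E.-integrable setT (EFin \o G).
  apply: (@le_integrable _ _ _ _ setT _ _ (EFin \o cst M)) => //.
  - exact/measurable_EFinP.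
  - move=> [x y] _ /=; rewrite lee_fin /G indicE/=.
    have [/set_mem[/= Sx Sy]|_] := boolP (_ \in _); last first.
      by rewrite mulr0 normr0.
    by rewrite mulr1 (le_trans (hM _ _ Sx Sy))// ler_norm.
  - apply/integrableP; split; first exact/measurable_EFinP.
    rewrite [X in (X < _)%E](_ : _ = \int[(mu \x mu)%E]_x (cst `|M|%:E x))%E//.
    have m1 : (mu \x mu)%E setT = 1%E.
      rewrite -setXTT; apply: (etrans (product_measure1E _ _ _ _)) => //.
      rewrite -[RHS]mule1; congr (_ * _)%E; exact: surface_setT1.
    rewrite integral_cst//.
    rewrite [X in (_ * X)%E]m1.
    by rewrite mule1 ltry.
have HF (K : T -> T -> R) : (forall x, S x -> measurable_fun setT (K x)) ->
    (forall x y, S x -> S y -> `|K x y| <= M) ->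
    mean (fun x => mean (K x)) =
    fine (\int[mu]_x \int[mu]_y ((K x y * \1_(S `*` S) (x, y))%:E))%E.
  move=> mK hK; rewrite /mean Rintegral_mkcond /Rintegral; congr fine.
  apply: eq_integral => x _; rewrite patchE.
  have [/set_mem Sx|xS] := boolP (x \in S); last first.
    rewrite integral0_eq// => y _; rewrite indicE.
    by rewrite (_ : _ \in _ = false) ?mulr0//;
      apply/negP => /set_mem[/= /mem_set]; rewrite (negbTE xS).
  rewrite fineK; last first.
    apply: integrable_fin_num => //; apply: bmf_integrable; split; first exact: mK.
    by exists M => y; exact: hK.
  rewrite integral_mkcond; apply: eq_integral => y _; rewrite patchE indicE.
  have [/set_mem Sy|yS] := boolP (y \in S).
    by rewrite mem_set ?mulr1.
  by rewrite (_ : _ \in _ = false) ?mulr0//;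
      apply/negP => /set_mem[/= _ /mem_set]; rewrite (negbTE yS).
rewrite (HF F)//; last first.
  by move=> x _; exact: (measurableT_comp mF (measurable_pair1 x)).
rewrite (HF (fun y x => F x y)); last 2 first.
- by move=> x _; exact: (measurableT_comp mF (measurable_pair2 x)).
- by move=> x y Sx Sy; exact: hM.
congr fine; apply: (etrans (Fubini iG)).
apply: eq_integral => x _; apply: eq_integral => y _; rewrite /G /= !indicE.
by congr (_ * (nat_of_bool _)%:R)%:E; apply/idP/idP => /set_mem[/= ? ?]; apply/mem_set.
Qed.

(** One reflection sends [x] to [x']. A second sends the image of [z] to [z']; it fixes [x'] because
    the equal inner products make [x'] orthogonal to its direction. *)
Lemma two_point_homogeneous (F : R -> R -> R) (x z x' z' : T) :
  S x -> S z -> S x' -> S z' -> dotp x z = dotp x' z' ->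
  bounded_measurable (fun y => F (dotp x' y) (dotp z' y)) ->
  mean (fun y => F (dotp x y) (dotp z y)) = mean (fun y => F (dotp x' y) (dotp z' y)).
Proof.
move=> /sphere_dotp Sx /sphere_dotp Sz /sphere_dotp Sx' /sphere_dotp Sz' xz bF.
pose v := axpy (-1) x' x.
have Q1x : mirror v x = x' by apply: mirror_swap; rewrite Sx.
pose w := axpy (-1) z' (mirror v z).
have Q2z : mirror w (mirror v z) = z' by apply: mirror_swap; rewrite dotp_mirror Sz.
have Q2x : mirror w x' = x'.
  apply: mirror_perp; rewrite dotpC dotp_axpy dotpC -{1}Q1x dotp_mirror xz dotpC; ring.
rewrite -(mean_mirror w bF).
have bG : bounded_measurable ((fun y => F (dotp x' y) (dotp z' y)) \o mirror w).
  have [mF [M hM]] := bF; split.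
    by apply: measurableT_comp => //; exact: measurable_mirror.
  by exists M => y Sy; apply: hM; apply/sphere_mirror.
rewrite -(mean_mirror v bG); apply: eq_mean => y _ /=.
have -> : dotp x y = dotp x' (mirror w (mirror v y)).
  by rewrite -Q2x dotp_mirror -Q1x dotp_mirror.
by have -> : dotp z y = dotp z' (mirror w (mirror v y)) by rewrite -Q2z !dotp_mirror.
Qed.

End mean.
#[local] Hint Resolve sphere_measurable : core.

(** * Level sets of a coordinate are null *)

Section sphere_geometry.
Context {R : realType}.
Variable d : nat.
Hypothesis d_ge1 : (1 <= d)%N.
Local Notation T := (d.+1.-tuple R).
Local Notation S := (sphere d : set T).
Local Notation mu := (@surface R d).

Definition axis (i : 'I_d.+1) : T := [tuple (i == j)%:R | j < d.+1].

Lemma dotp_axis i (y : T) : dotp (axis i) y = tnth y i.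
Proof.
rewrite /dotp (bigD1 i)//= tnth_mktuple eqxx mul1r big1 ?addr0// => j ji.
by rewrite tnth_mktuple eq_sym (negbTE ji) mul0r.
Qed.

Lemma sphere_axis i : S (axis i).
Proof. by apply/sphere_dotp; rewrite dotp_axis tnth_mktuple eqxx. Qed.

Definition pole : T := axis ord0.
(** A single point of the equator relative to [pole]; for [d >= 1] the index [inord 1] is the second
    coordinate. *)
Definition equator : T := axis (inord 1).

Lemma sphere_pole : S pole. Proof. exact: sphere_axis. Qed.
Lemma sphere_equator : S equator. Proof. exact: sphere_axis. Qed.

Lemma dotp_pole_equator : dotp pole equator = 0.
Proof.
rewrite dotp_axis tnth_mktuple (_ : _ == _ = false)//; apply/negbTE/eqP.
by move=> /(congr1 val); rewrite /= inordK.
Qed.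

Lemma exists_orthogonal (z : T) : S z -> exists2 w : T, S w & dotp z w = 0.
Proof.
move=> /sphere_dotp z1; pose v := axpy (-1) z pole.
have vz : mirror v pole = z.
  by apply: mirror_swap; rewrite z1; apply/sphere_dotp; exact: sphere_pole.
exists (mirror v equator); first by apply/sphere_mirror; exact: sphere_equator.
by rewrite -{1}vz dotp_mirror dotp_pole_equator.
Qed.

Definition level (z : T) (c : R) : set T := [set y | S y /\ dotp z y = c].

Lemma measurable_level z c : measurable (level z c).
Proof.
rewrite (_ : level z c = S `&` (fun y => dotp z y) @^-1` [set c])//.
apply: measurableI => //.
apply: (@measurable_preimage _ _ _ R (fun y : T => dotp z y) [set c]) => //.
exact: measurable_dotpl.
Qed.

Lemma level_lt1 (c : R) : `|c| < 1 -> mu (level pole c) = 0%E.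
Proof.
move=> c1; rewrite /surface [X in (_ * X)%E](_ : _ = 0%E) ?mule0//.
set A := cone _.
have mA : measurable A by apply: measurable_cone; exact: measurable_level.
have mcA : measurable (@tuple_cons R d @^-1` A).
  by apply: measurable_preimage mA; exact: measurable_tuple_cons.
rewrite /= /lebesgue_cons.
rewrite (@product_measure_unique _ _ _ _ R (@lebesgue_measure R) (lebesgue_tuple d)
  (lebesgue_measure \x^ lebesgue_tuple d)%E)//; last first.
  by move=> C D mC mD /=; rewrite product_measure2E.
apply: integral0_eq => t _ /=.
(* For a fixed tail [t], a point [(x, t)] of the cone has [x = c e] with [e^2 = x^2 + <t, t>], which
   leaves only [x = r] and [x = - r]. *)
pose r := Num.sqrt (c ^+ 2 * dotp t t / (1 - c ^+ 2)).
have c2 : c ^+ 2 < 1 by rewrite -(expr1n _ 2) -[c ^+ 2]real_normK ?num_real// ltrXn2r.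
apply/eqP; rewrite eq_le measure_ge0 andbT.
apply: (@le_trans _ _ (lebesgue_measure ([set r] `|` [set - r]))).
  apply: le_measure; rewrite ?inE.
  - exact: measurable_ysection.
  - by apply: measurableU; exact: measurable_set1.
  move=> x; rewrite /ysection/= inE /A /cone /level /= dotp_axis /normalize tnth_mktuple.
  rewrite tnth0 => -[/andP[e0 _] [_ xc]].
  set e := enorm _ in e0 xc.
  have ee : e ^+ 2 = x ^+ 2 + dotp t t.
    by rewrite /e /enorm sqr_sqrtr ?dotp_ge0// dotp_cons/= expr2.
  have xE : x = c * e by rewrite -xc mulrAC mulVf ?mul1r// gt_eqF.
  have x2 : x ^+ 2 = r ^+ 2.
    rewrite /r sqr_sqrtr; last first.
      by rewrite mulr_ge0 ?invr_ge0 ?subr_ge0 ?(ltW c2)// mulr_ge0 ?sqr_ge0 ?dotp_ge0.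
    have cn : 1 - c ^+ 2 != 0 by rewrite subr_eq0 gt_eqF.
    apply: (mulIf cn); rewrite mulfVK//.
    have : x ^+ 2 = c ^+ 2 * e ^+ 2 by rewrite xE exprMn.
    by rewrite ee => h; rewrite mulrBr mulr1 {1}h; ring.
  by move/eqP : x2; rewrite eqf_sqr => /orP[] /eqP ->; [left|right].
apply: (le_trans (measureU2 _ _ _)) => //.
by rewrite /= !lebesgue_measure_set1 adde0.
Qed.

Lemma mean_eq_level z c : mean (fun y => (dotp z y == c)%:R) = fine (mu (level z c)).
Proof.
rewrite -[in RHS](setIidl (_ : level z c `<=` S)); last by move=> y [].
rewrite -mean_indic; last exact: measurable_level.
apply: eq_mean => y Sy; rewrite indicE; congr (nat_of_bool _)%:R.
by apply/eqP/idP => [?|/set_mem[]//]; rewrite inE.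
Qed.

Lemma level_null z c : S z -> mu (level z c) = 0%E.
Proof.
have key x (c' : R) : S x -> `|c'| < 1 -> mu (level x c') = 0%E.
  move=> Sx c1; apply/eqP.
  rewrite -fine_eq0 ?fin_num_measure//; last exact: measurable_level.
  rewrite -mean_eq_level.
  (* Homogeneity moves pairs, so the single point [x] is completed by an orthogonal one, to be
     matched with [pole] and [equator]. *)
  have [y Sy xy] := exists_orthogonal Sx.
  rewrite (@two_point_homogeneous _ _ (fun s _ => (s == c')%:R) x y pole equator)//.
  - by rewrite mean_eq_level level_lt1.
  - exact: sphere_pole.
  - exact: sphere_equator.
  - by rewrite xy dotp_pole_equator.
  - have mE : measurable (level pole c') by exact: measurable_level.
    split; last by exists 1 => u _; case: (_ == _); rewrite ?normr1 ?normr0.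
    rewrite (_ : (fun y => _) = \1_((fun u => dotp pole u) @^-1` [set c'])).
      apply: measurable_indic.
      apply: (@measurable_preimage _ _ _ R (fun u : T => dotp pole u) [set c']) => //.
      exact: measurable_dotpl.
    apply/funext => u; rewrite indicE; congr (nat_of_bool _)%:R.
    by apply/eqP/idP => [?|/set_mem//]; rewrite inE.
(* For [|c| >= 1], Bessel's inequality puts the level set inside a hyperplane. *)
move=> Sz; have [|c1] := ltP `|c| 1; first exact: key.
have [w Sw zw] := exists_orthogonal Sz.
apply/eqP; rewrite eq_le measure_ge0 andbT -(key w 0)// ?normr0//.
apply: le_measure; rewrite ?inE; try exact: measurable_level.
move=> y [Sy zy]; split => //.
have := dotp_ge0 (axpy (- dotp z y) z (axpy (- dotp w y) w y)).
rewrite !(dotp_axpy, dotpC _ (axpy _ _ _)).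
move: Sz Sw Sy => /sphere_dotp z1 /sphere_dotp w1 /sphere_dotp y1.
rewrite [dotp y z]dotpC [dotp y w]dotpC [dotp w z]dotpC zw z1 w1 y1 zy.
have {}c1 : 1 <= c ^+ 2 by rewrite -[c ^+ 2]real_normK ?num_real// exprn_ege1.
move=> h; have : dotp w y ^+ 2 <= 0 by nra.
by rewrite le_eqVlt ltNge sqr_ge0 orbF sqrf_eq0 => /eqP.
Qed.

End sphere_geometry.

(** * Zonal functions and the Funk-Hecke formula *)

Section zonal.
Context {R : realType}.
Variable d : nat.
Hypothesis d_ge1 : (1 <= d)%N.
Local Notation T := (d.+1.-tuple R).
Local Notation S := (sphere d : set T).
Local Notation mu := (@surface R d).
Local Notation e0 := (@pole R d).
Local Notation e1 := (@equator R d).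

Definition bounded_measurable1 (f : R -> R) :=
  measurable_fun setT f /\ exists M, forall t, `|t| <= 1 -> `|f t| <= M.

Lemma bmf_zonal f x : bounded_measurable1 f -> S x -> bounded_measurable (fun y => f (dotp x y)).
Proof.
move=> [mf [M hM]] Sx; split; first by apply: measurableT_comp => //; exact: measurable_dotpl.
by exists M => y Sy; apply: hM; exact: dotp_le1.
Qed.

Lemma bm1_gt (c : R) : bounded_measurable1 (fun t => (c < t)%R%:R).
Proof.
split; first exact: measurable_fun_gt.
by exists 1 => t _; case: (_ < _); rewrite ?normr1 ?normr0.
Qed.

Lemma bm1_horner (p : {poly R}) : bounded_measurable1 (horner p).
Proof.
elim/poly_ind: p => [|p c [mp [M hM]]].
  split; last by exists 0 => t _; rewrite horner0 normr0.
  by rewrite (_ : horner 0 = cst 0)//; apply/funext => t; rewrite horner0.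
split.
  rewrite (_ : horner _ = (fun t => p.[t] * t + c)); last first.
    by apply/funext => t; rewrite hornerMXaddC.
  by apply: measurable_funD => //; exact: measurable_funM.
exists (M + `|c|) => t t1; rewrite hornerMXaddC (le_trans (ler_normD _ _))// lerD2r.
rewrite normrM (le_trans (ler_piMr _ t1))//; exact: hM.
Qed.

Lemma Fubini_zonal e (A B C : R -> R) : S e ->
  bounded_measurable1 A -> bounded_measurable1 B -> bounded_measurable1 C ->
  mean (fun x : T => A (dotp e x) * mean (fun y => B (dotp e y) * C (dotp x y))) =
  mean (fun y : T => B (dotp e y) * mean (fun x => A (dotp e x) * C (dotp y x))).
Proof.
move=> Se bA bB bC.
transitivity (mean (fun x : T => mean (fun y => A (dotp e x) * (B (dotp e y) * C (dotp x y))))).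
  apply: eq_mean => x Sx; rewrite meanZ//.
  by apply: bmfM; exact: bmf_zonal.
have [[mA [MA hA]] [mB [MB hB]] [mC [MC hC]]] := And3 bA bB bC.
rewrite (@Fubini_mean R d (fun x y => A (dotp e x) * (B (dotp e y) * C (dotp x y)))
  (MA * (MB * MC))).
- apply: eq_mean => y Sy; rewrite -meanZ; last by apply: bmfM; exact: bmf_zonal.
  by apply: eq_mean => x _; rewrite mulrCA [dotp x y]dotpC.
- apply: measurable_funM.
    apply: measurableT_comp => //.
    by apply: measurable_dotpl; [exact: measurable_cst|exact: measurable_fst].
  apply: measurable_funM.
    apply: measurableT_comp => //.
    by apply: measurable_dotpl; [exact: measurable_cst|exact: measurable_snd].
  apply: measurableT_comp => //.
  by apply: measurable_dotpl; [exact: measurable_fst|exact: measurable_snd].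
- move=> x y Sx Sy; rewrite !normrM ler_pM//.
  + by apply: hA; exact: dotp_le1.
  + by rewrite ler_pM//; [apply: hB; exact: dotp_le1|apply: hC; exact: dotp_le1].
Qed.

Definition zeros (r : {poly R}) : set T := S `&` [set y | r.[dotp e0 y] = 0].

Lemma measurable_zeros r : measurable (zeros r).
Proof.
apply: measurableI => //.
apply: (@measurable_preimage _ _ _ R (fun y : T => r.[dotp e0 y]) [set 0]) => //.
by have [] := bmf_zonal (bm1_horner r) (sphere_pole d).
Qed.

(** Splitting off one root at a time covers the zero set by null level sets. *)
Lemma zeros_null (r : {poly R}) : r != 0 -> mu (zeros r) = 0%E.
Proof.
have [n] := ubnP (size r); elim: n r => // n IH r rn r0.
have [[c rc]|nr] := pselect (exists c, root r c); last first.
  rewrite (_ : zeros r = set0) ?measure0//; apply/seteqP; split => // y [_ /= ry].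
  by apply: nr; exists (dotp e0 y); apply/eqP.
have /factor_theorem[q rE] := rc.
have q0 : q != 0 by apply: contraNneq r0 => q0; rewrite rE q0 mul0r.
have qn : (size q < n)%N.
  move: rn; rewrite rE size_Mmonic ?monicXsubC// size_XsubC addn2 /= ltnS.
  by [].
have mq := measurable_zeros q.
have ml := measurable_level e0 c.
apply/eqP; rewrite eq_le measure_ge0 andbT.
apply: (@le_trans _ _ (mu (zeros q `|` level e0 c))).
  apply: le_measure; rewrite ?inE; [exact: measurable_zeros|exact: measurableU|].
  move=> y [Sy /=]; rewrite rE hornerM !hornerE => /eqP; rewrite mulf_eq0 => /orP[/eqP|].
    by left.
  by rewrite subr_eq0 => /eqP; right.
apply: (le_trans (measureU2 _ _ _)) => //.
have le0 : mu (level e0 c) = 0%E by apply: level_null => //; exact: sphere_pole.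
by move: (IH q qn q0) le0 => /= -> ->; rewrite adde0.
Qed.

(** Turns a vanishing mean square into a polynomial identity: otherwise the sphere would be covered
    by the zeros of [r] and an exceptional null set. *)
Lemma zonal_definite (r : {poly R}) :
  mean (fun y : T => r.[dotp e0 y] ^+ 2) = 0 -> r = 0.
Proof.
move=> h; apply/eqP/negPn/negP => r0.
have br : bounded_measurable (fun y : T => r.[dotp e0 y] ^+ 2).
  by apply: bmfX; exact: (bmf_zonal (bm1_horner r) (sphere_pole d)).
have ir := bmf_integrable br.
have : (\int[mu]_(y in S) `|(r.[dotp e0 y] ^+ 2)%:E| = 0)%E.
  under eq_integral do rewrite gee0_abs ?lee_fin ?sqr_ge0//.
  rewrite -[LHS]fineK; last by apply: integrable_fin_num => //; exact: sphere_measurable.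
  by move: h; rewrite /mean /Rintegral => ->.
have mr : measurable_fun S (fun y => (r.[dotp e0 y] ^+ 2)%:E).
  by have /integrableP[] := ir.
move=> /(ae_eq_integral_abs mu (@sphere_measurable R d) mr)[N [mN N0 subN]].
have : (mu S <= mu (zeros r `|` N))%E.
  apply: le_measure; rewrite ?inE//; first by apply: measurableU => //; exact: measurable_zeros.
  move=> y Sy; have [ry|ry] := eqVneq r.[dotp e0 y] 0; first by left.
  right; apply: subN => /= /(_ Sy) [] /eqP; rewrite sqrf_eq0; exact/negP.
have -> : mu S = 1%E by exact: surface_sphere.
apply/negP; rewrite -ltNge.
apply: (le_lt_trans (measureU2 _ _ _)) => //; first exact: measurable_zeros.
by move: (zeros_null r0) N0 => /= -> ->; rewrite adde0 lte_fin ltr01.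
Qed.

(** Up to the factor ['C(k, j)], the coefficient of [s^(k - j) r^j] in the mean of
    [f(y0) (s y0 + r y1)^k]. *)
Definition zonal_moment (f : R -> R) (k j : nat) : R :=
  mean (fun y : T => f (dotp e0 y) * (dotp e0 y ^+ (k - j) * dotp e1 y ^+ j)).

Lemma zonal_moment_odd f k j : bounded_measurable1 f -> odd j -> zonal_moment f k j = 0.
Proof.
move=> bf oj; have Se0 : S e0 by exact: sphere_pole.
have Se1 : S e1 by exact: sphere_equator.
have b : bounded_measurable (fun y : T => f (dotp e0 y) * (dotp e0 y ^+ (k - j) * dotp e1 y ^+ j)).
  apply: bmfM; first exact: bmf_zonal.
  by apply: bmfM; apply: bmfX; exact: bmf_dotp.
apply/eqP; rewrite -[_ == 0]orFb -(negbTE (oner_neq0 R)).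
have : zonal_moment f k j = - zonal_moment f k j.
  rewrite /zonal_moment -[LHS](mean_mirror e1)// -mulN1r -meanZ//.
  have m1 : mirror e1 e1 = axpy (-2) e1 e1.
    by rewrite /mirror (sphere_dotp _).1// divr1 mulr1.
  have m0 : mirror e1 e0 = e0 by apply: mirror_perp; exact: dotp_pole_equator.
  apply: eq_mean => y _ /=.
  have -> : dotp e0 (mirror e1 y) = dotp e0 y by rewrite -{1}m0 dotp_mirror.
  have -> : dotp e1 (mirror e1 y) = - dotp e1 y.
    have := dotp_mirror e1 e1 y; rewrite m1 dotp_axpy => <-; ring.
  by rewrite exprNn -signr_odd oj expr1 !mulrA; ring.
by move=> /eqP; rewrite -addr_eq0 -mulr2n mulrn_eq0 /= => /eqP ->; rewrite eqxx orbT.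
Qed.

Lemma two_point_standard (x z : T) (F : R -> R -> R) :
  let s := dotp x z in let r := Num.sqrt (1 - s ^+ 2) in
  S x -> S z ->
  (forall x' z', S x' -> S z' -> bounded_measurable (fun y : T => F (dotp x' y) (dotp z' y))) ->
  mean (fun y : T => F (dotp x y) (dotp z y)) =
  mean (fun y : T => F (dotp e0 y) (s * dotp e0 y + r * dotp e1 y)).
Proof.
move=> s r Sx Sz bF.
have Se0 : S e0 by exact: sphere_pole.
have Se1 : S e1 by exact: sphere_equator.
(* This is [s e0 + r e1], a unit vector with [<e0, w> = s = <x, z>]. *)
pose w := axpy r e1 (axpy (s - 1) e0 e0).
have dw y : dotp w y = s * dotp e0 y + r * dotp e1 y by rewrite /w !dotp_axpy; ring.
have e01 : dotp e0 e1 = 0 by exact: dotp_pole_equator.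
have e00 : dotp e0 e0 = 1 by apply/sphere_dotp.
have e11 : dotp e1 e1 = 1 by apply/sphere_dotp.
have s1 : s ^+ 2 <= 1.
  by rewrite -[s ^+ 2]real_normK ?num_real// expr_le1// dotp_le1.
have r2 : r ^+ 2 = 1 - s ^+ 2 by rewrite sqr_sqrtr// subr_ge0.
have Sw : S w.
  apply/sphere_dotp; rewrite dw ![dotp _ w]dotpC !dw [dotp e1 e0]dotpC e01 e00 e11.
  by rewrite !mulr0 !mulr1 addr0 add0r -!expr2 r2; ring.
rewrite (@two_point_homogeneous R d F x z e0 w)//.
- by apply: eq_mean => y _; rewrite dw.
- by rewrite [RHS]dotpC dw e00 [dotp e1 e0]dotpC e01 mulr1 mulr0 addr0.
- exact: bF.
Qed.

(* With [x = e0] and [z = s e0 + r e1], [r^2 = 1 - s^2], expand [<z, y>^k]; the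
   odd powers of [r] disappear by reflection along [e1]. *)
Lemma zonal_monomial (f : R -> R) (k : nat) : bounded_measurable1 f ->
  exists2 q : {poly R}, (size q <= k.+1)%N & forall x z : T, S x -> S z ->
    mean (fun y : T => f (dotp x y) * dotp z y ^+ k) = q.[dotp x z].
Proof.
move=> bf; have Se0 : S e0 by exact: sphere_pole.
have Se1 : S e1 by exact: sphere_equator.
(* For even [j], [r^j = (1 - s^2)^(j / 2)] is a polynomial in [s], and each term has degree at most
   [(k - j) + j = k]. For odd [j] the coefficient is zero, so the rounding in [j./2] is harmless. *)
exists (\sum_(j < k.+1) ((zonal_moment f k j * 'C(k, j)%:R)%:P
    * ('X ^+ (k - j) * (1 - 'X ^+ 2) ^+ j./2))).
  rewrite (leq_trans (size_sum _ _ _))//; apply/bigmax_leqP => j _.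
  have [oj|ej] := boolP (odd j); first by rewrite zonal_moment_odd// mul0r mul0r size_poly0.
  rewrite mul_polyC (leq_trans (size_scale_leq _ _))//.
  rewrite (leq_trans (size_polyMleq _ _))// size_polyXn addSn /=.
  have := size_poly_exp_leq (1 - 'X ^+ 2 : {poly R}) j./2.
  have : (size (1 - 'X ^+ 2 : {poly R})%R <= 3)%N.
    by rewrite (leq_trans (size_polyD _ _))// size_polyN size_polyXn size_poly1.
  have := odd_double_half j; rewrite (negbTE ej) add0n => hj.
  have := ltn_ord j; rewrite ltnS => jk.
  move: (size (1 - 'X^2)) => m hm hs.
  have : (m.-1 * j./2 <= 2 * j./2)%N by rewrite leq_mul2r; apply/orP; right; case: m hm {hs}.
  rewrite mul2n hj => h2.
  rewrite (@leq_trans (k - j + j.+1))//; last by rewrite addnS subnK.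
  by rewrite leq_add2l (leq_trans hs).
move=> x z Sx Sz; set s := dotp x z; pose r := Num.sqrt (1 - s ^+ 2).
have s1 : s ^+ 2 <= 1.
  by rewrite -[s ^+ 2]real_normK ?num_real// expr_le1// dotp_le1.
have r2 : r ^+ 2 = 1 - s ^+ 2 by rewrite sqr_sqrtr// subr_ge0.
rewrite (@two_point_standard x z (fun a b => f a * b ^+ k))//; last first.
  by move=> x' z' Sx' Sz'; apply: bmfM; [exact: bmf_zonal|apply: bmfX; exact: bmf_dotp].
rewrite -/s -/r horner_sum.
transitivity (mean (fun y : T => \sum_(j < k.+1) ('C(k, j)%:R * s ^+ (k - j) * r ^+ j) *
    (f (dotp e0 y) * (dotp e0 y ^+ (k - j) * dotp e1 y ^+ j)))).
  apply: eq_mean => y _; rewrite exprDn mulr_sumr; apply: eq_bigr => j _.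
  by rewrite !exprMn -mulr_natl; ring.
have bj (j : 'I_k.+1) :
    bounded_measurable (fun y : T => f (dotp e0 y) * (dotp e0 y ^+ (k - j) * dotp e1 y ^+ j)).
  apply: bmfM; first exact: bmf_zonal.
  by apply: bmfM; apply: bmfX; exact: bmf_dotp.
rewrite mean_sum; last by move=> j; exact: bmfZ.
apply: eq_bigr => j _; rewrite meanZ// -/(zonal_moment f k j) !hornerE /=.
have [oj|ej] := boolP (odd j); first by rewrite zonal_moment_odd// mulr0 !mul0r.
have rj : r ^+ j = (1 - s ^+ 2) ^+ j./2.
  rewrite -r2 -exprM mul2n; congr (_ ^+ _).
  by rewrite -[LHS]odd_double_half (negbTE ej).
by rewrite rj; ring.
Qed.

Lemma zonal_poly (f : R -> R) (p : {poly R}) : bounded_measurable1 f ->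
  exists2 q : {poly R}, (size q <= size p)%N & forall x z : T, S x -> S z ->
    mean (fun y : T => f (dotp x y) * p.[dotp z y]) = q.[dotp x z].
Proof.
move=> bf.
have /choice[q hq] : forall k, exists q : {poly R}, (size q <= k.+1)%N /\
    forall x z : T, S x -> S z ->
    mean (fun y : T => f (dotp x y) * dotp z y ^+ k) = q.[dotp x z].
  by move=> k; have [q q1 q2] := zonal_monomial k bf; exists q.
exists (\sum_(k < size p) p`_k *: q k).
  rewrite (leq_trans (size_sum _ _ _))//; apply/bigmax_leqP => k _.
  by rewrite (leq_trans (size_scale_leq _ _))// (leq_trans (hq k).1).
move=> x z Sx Sz; rewrite horner_sum.
transitivity (mean (fun y : T => \sum_(k < size p) p`_k * (f (dotp x y) * dotp z y ^+ k))).
  apply: eq_mean => y _; rewrite horner_coef mulr_sumr; apply: eq_bigr => k _; ring.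
have bk k : bounded_measurable (fun y : T => f (dotp x y) * dotp z y ^+ k).
  by apply: bmfM; [exact: bmf_zonal|apply: bmfX; exact: bmf_dotp].
rewrite mean_sum; last by move=> k; exact: bmfZ.
by apply: eq_bigr => k _; rewrite meanZ// (hq k).2// hornerZ.
Qed.

(* Let [r(<x, z>)] be the left-hand side of the conclusion. Writing one factor of
   [r(<e0, x>)^2] as that mean and exchanging the two means gives
   [E r(<e0, x>)^2 = E P(<e0, y>) q(<e0, y>)] with [size q <= size r <= k]. *)
Lemma zonal_ortho (P : {poly R}) (k : nat) :
  (forall p : {poly R}, (size p <= k)%N ->
    mean (fun y : T => P.[dotp e0 y] * p.[dotp e0 y]) = 0) ->
  forall p : {poly R}, (size p <= k)%N -> forall x z : T, S x -> S z ->
    mean (fun y : T => P.[dotp x y] * p.[dotp z y]) = 0.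
Proof.
move=> H p pk; have Se0 : S e0 by exact: sphere_pole.
have [r rp hr] := zonal_poly p (bm1_horner P).
suff r0 : r = 0 by move=> x z Sx Sz; rewrite hr// r0 horner0.
apply: zonal_definite.
have [q qr hq] := zonal_poly r (bm1_horner p).
transitivity (mean (fun x : T => r.[dotp e0 x] *
    mean (fun y : T => P.[dotp e0 y] * p.[dotp x y]))).
  by apply: eq_mean => x Sx; rewrite hr// expr2.
rewrite (@Fubini_zonal e0 (horner r) (horner P) (horner p))//; try exact: bm1_horner.
rewrite -[RHS](H q); last by rewrite (leq_trans qr)// (leq_trans rp).
apply: eq_mean => y Sy; congr (_ * _).
by rewrite dotpC -hq//; apply: eq_mean => x _; rewrite mulrC.
Qed.

(* The left-hand side is [h(<x, z>)] with [size h <= n.+1]; subtracting a multiple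
   of [P] from [h] leaves [g] with [size g <= n], and [E g^2 = 0] by orthogonality. *)
Lemma Funk_Hecke (P : {poly R}) (n : nat) (f : R -> R) :
  size P = n.+1 -> P.[1] = 1 -> bounded_measurable1 f ->
  (forall p : {poly R}, (size p <= n)%N ->
    mean (fun y : T => P.[dotp e0 y] * p.[dotp e0 y]) = 0) ->
  forall x z : T, S x -> S z ->
    mean (fun y : T => f (dotp x y) * P.[dotp z y]) =
    mean (fun y : T => f (dotp e0 y) * P.[dotp e0 y]) * P.[dotp x z].
Proof.
move=> sP P1 bf H; have Se0 : S e0 by exact: sphere_pole.
have [h hP hh] := zonal_poly P bf; rewrite sP in hP.
pose c := h`_n / P`_n; pose g := h - c *: P.
have Pn0 : P`_n != 0 by rewrite -[n]/(n.+1.-1) -sP -/(lead_coef P) lead_coef_eq0 -size_poly_eq0 sP.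
have gn : (size g <= n)%N.
  apply/leq_sizeP => j; rewrite leq_eqVlt => /predU1P[<-|nj]; rewrite /g coefB coefZ.
    by rewrite /c divfK ?subrr.
  by rewrite !nth_default ?sP// ?mulr0 ?subr0// (leq_trans hP).
have bh p : bounded_measurable (fun y : T => horner p (dotp e0 y)).
  by apply: bmf_zonal => //; exact: bm1_horner.
have g0 : g = 0.
  apply: zonal_definite.
  transitivity (mean (fun y : T => g.[dotp e0 y] * h.[dotp e0 y] -
      c * (P.[dotp e0 y] * g.[dotp e0 y]))).
    apply: eq_mean => y _; have : g.[dotp e0 y] = h.[dotp e0 y] - c * P.[dotp e0 y].
      by rewrite !hornerE.
    by move: g.[_] h.[_] P.[_] => G A B ->; ring.
  rewrite meanB; [|by apply: bmfM|by apply: bmfZ; apply: bmfM].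
  rewrite meanZ; last exact: bmfM.
  rewrite H// mulr0 subr0.
  (* Writing [h] as its defining mean and exchanging the means pairs [g] with [P] along two
     different axes, where [zonal_ortho] applies. *)
  transitivity (mean (fun x : T => g.[dotp e0 x] *
      mean (fun y : T => f (dotp e0 y) * P.[dotp x y]))).
    by apply: eq_mean => x Sx; rewrite hh.
  rewrite (@Fubini_zonal e0 (horner g) f (horner P))//; try exact: bm1_horner.
  rewrite -[RHS](@mean_cst R d); apply: eq_mean => y Sy.
  rewrite (_ : mean _ = 0) ?mulr0//.
  rewrite -[RHS](zonal_ortho H gn Sy Se0).
  by apply: eq_mean => x _; rewrite mulrC.
have hE : h = c *: P by apply/eqP; rewrite -subr_eq0 -/g g0.
have e00 : dotp e0 e0 = 1 by apply/sphere_dotp.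
move=> x z Sx Sz; rewrite !hh// e00 hE !hornerZ P1 mulr1//.
Qed.

End zonal.

(** * Moments of a coordinate and positivity of caps *)

Section moments.
Context {R : realType}.
Variable d : nat.
Hypothesis d_ge1 : (1 <= d)%N.
Local Notation T := (d.+1.-tuple R).
Local Notation S := (sphere d : set T).
Local Notation mu := (@surface R d).
Local Notation e0 := (@pole R d).
Local Notation e1 := (@equator R d).

Definition moment (k : nat) : R := mean (fun y : T => dotp e0 y ^+ k).

Let Se0 : S e0. Proof. exact: sphere_pole. Qed.
Let Se1 : S e1. Proof. exact: sphere_equator. Qed.

Lemma bmf_monomial (i : 'I_d.+1) k l :
  bounded_measurable (fun y : T => dotp e0 y ^+ k * dotp (axis i) y ^+ l).
Proof. by apply: bmfM; apply: bmfX; apply: bmf_dotp => //; exact: sphere_axis. Qed.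

Lemma bmf_moment k : bounded_measurable (fun y : T => dotp e0 y ^+ k).
Proof. by apply: bmfX; exact: bmf_dotp. Qed.

Lemma moment0 : moment 0 = 1.
Proof. by rewrite /moment; under eq_fun do rewrite expr0; rewrite mean_cst. Qed.

Lemma mean_opp_pole (f : R -> R) : bounded_measurable1 f ->
  mean (fun y : T => f (- dotp e0 y)) = mean (fun y : T => f (dotp e0 y)).
Proof.
move=> bf; rewrite -(mean_mirror e0 (bmf_zonal bf Se0)); apply: eq_mean => y _ /=.
have m1 : mirror e0 e0 = axpy (-2) e0 e0.
  by rewrite /mirror (sphere_dotp _).1// divr1 mulr1.
congr f; have := dotp_mirror e0 e0 y; rewrite m1 dotp_axpy => <-; ring.
Qed.

Lemma moment_odd k : odd k -> moment k = 0.
Proof.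
move=> ok; have : moment k = - moment k.
  rewrite /moment -mulN1r -meanZ; last exact: bmf_moment.
  have -> : (fun y : T => dotp e0 y ^+ k) = (fun y => ('X^k : {poly R}).[dotp e0 y]).
    by apply/funext => y; rewrite hornerXn.
  rewrite -mean_opp_pole; last exact: bm1_horner.
  by apply: eq_mean => y _; rewrite !hornerXn exprNn -signr_odd ok.
by move=> /eqP; rewrite -addr_eq0 -mulr2n mulrn_eq0 /= => /eqP.
Qed.

(* Comparing the coefficients of [u^2] in [E (y0 + u y1)^(2m) = M_(2m) (1 + u^2)^m]. *)
Lemma moment_mixed n :
  (2 * n + 1)%:R * mean (fun y : T => dotp e0 y ^+ (2 * n) * dotp e1 y ^+ 2) =
  moment (2 * n + 2).
Proof.
set m := n.+1; have m2 : (2 * n + 2 = 2 * m)%N by rewrite /m mulnS addnC.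
pose c (j : nat) : R := mean (fun y : T => dotp e0 y ^+ (2 * m - j) * dotp e1 y ^+ j).
pose p : {poly R} := \sum_(j < (2 * m).+1) ('C(2 * m, j)%:R * c j) *: 'X^j.
pose q : {poly R} := moment (2 * m) *: (1 + 'X^2) ^+ m.
have pq u : p.[u] = q.[u].
  have u2 : 0 < 1 + u ^+ 2 by rewrite ltr_pwDl// sqr_ge0.
  pose r := Num.sqrt (1 + u ^+ 2).
  have r0 : r != 0 by rewrite gt_eqF// sqrtr_gt0.
  have r2 : r ^+ 2 = 1 + u ^+ 2 by rewrite sqr_sqrtr// ltW.
  (* This is [(e0 + u e1) / r], of unit length, so the mean of [<z, y>^(2m)] is a moment of the pole
     coordinate. *)
  pose z := axpy (u / r) e1 (axpy (r^-1 - 1) e0 e0).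
  have dz y : dotp z y = (dotp e0 y + u * dotp e1 y) / r by rewrite /z !dotp_axpy; field.
  have e01 : dotp e0 e1 = 0 by exact: dotp_pole_equator.
  have e00 : dotp e0 e0 = 1 by apply/sphere_dotp.
  have e11 : dotp e1 e1 = 1 by apply/sphere_dotp.
  have Sz : S z.
    apply/sphere_dotp; rewrite dz ![dotp _ z]dotpC !dz [dotp e1 e0]dotpC e01 e00 e11.
    have -> : ((1 + u * 0) / r + u * ((0 + u * 1) / r)) / r = (1 + u ^+ 2) / r ^+ 2 by field.
    by rewrite -r2 divff// expf_eq0.
  have pE : p.[u] = mean (fun y : T => (dotp e0 y + u * dotp e1 y) ^+ (2 * m)).
    transitivity (mean (fun y : T => \sum_(j < (2 * m).+1) ('C(2 * m, j)%:R * u ^+ j) *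
        (dotp e0 y ^+ (2 * m - j) * dotp e1 y ^+ j))).
      rewrite mean_sum; last by move=> j; apply: bmfZ; exact: bmf_monomial.
      rewrite horner_sum; apply: eq_bigr => j _; rewrite meanZ; last exact: bmf_monomial.
      by rewrite !hornerE /c; ring.
    apply: eq_mean => y _; rewrite exprDn; apply: eq_bigr => j _.
    by rewrite !exprMn -mulr_natl; ring.
  have [y0 Sy0 zy0] := exists_orthogonal d_ge1 Sz.
  rewrite pE /q hornerZ horner_exp !hornerE -r2 -exprM [(2 * m)%N in RHS]mulnC.
  rewrite [X in _ = X * _](_ : _ = mean (fun y : T => dotp z y ^+ (m * 2))); last first.
    rewrite /moment.
    rewrite (@two_point_homogeneous R d (fun s _ => s ^+ (m * 2)) z y0 e0 e1)//.
      by rewrite zy0 e01.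
    exact: bmf_moment.
  rewrite -meanZr; last by apply: bmfX; exact: bmf_dotp.
  by apply: eq_mean => y _; rewrite dz -exprMn divfK// [(m * 2)%N]mulnC.
have {pq} pq : p = q.
  apply/eqP; rewrite -subr_eq0; apply/negPn/negP => h.
  pose rs : seq R := [seq i%:R | i <- iota 0 (size (p - q))].
  have := max_poly_roots h (_ : all (root (p - q)) rs) (_ : uniq rs).
  rewrite size_map size_iota ltnn => H; apply: notF; apply: H.
    by apply/allP => x _; rewrite /root hornerD hornerN pq subrr.
  rewrite map_inj_uniq ?iota_uniq// => i j /eqP; rewrite eqr_nat => /eqP//.
have {pq} : p`_2 = q`_2 by rewrite pq.
rewrite /p /q coefZ coef_sum.
have m2lt : (2 < (2 * m).+1)%N by rewrite /m mulnS.
rewrite (bigD1 (Ordinal m2lt))//= coefZ coefXn eqxx mulr1 big1 ?addr0; last first.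
  move=> j /eqP j2; rewrite coefZ coefXn (_ : (2 == j)%N = false) ?mulr0//.
  by apply/negbTE/eqP => h; apply: j2; apply: val_inj.
rewrite exprDn coef_sum.
have m1lt : (1 < m.+1)%N by [].
rewrite (bigD1 (Ordinal m1lt))//= big1 ?addr0; last first.
  move=> j /eqP j1; rewrite expr1n mul1r -exprM coefMn coefXn.
  rewrite (_ : (2 == 2 * j)%N = false) ?mul0rn//.
  apply/negbTE/eqP => h; apply: j1; apply: val_inj => /=.
  by apply/eqP; rewrite -(eqn_pmul2l (isT : (0 < 2)%N)) -h.
rewrite expr1n mul1r expr1 coefMn coefXn eqxx bin1 -m2.
have -> : c 2 = mean (fun y : T => dotp e0 y ^+ (2 * n) * dotp e1 y ^+ 2).
  by rewrite /c -m2 addnK.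
have bE : 'C(2 * n + 2, 2)%:R = m%:R * (2 * n + 1)%:R :> R.
  rewrite -natrM; congr (_%:R); rewrite bin2 m2 mul2n -doubleMl doubleK.
  by rewrite /m doubleS /= addn1 mul2n.
rewrite bE => h; have m0 : m%:R != 0 :> R by rewrite pnatr_eq0.
by apply: (mulfI m0); rewrite mulrA h mulrC.
Qed.

(** Multiply [1 - y0^2 = y1^2 + ... + yd^2] by [y0^k] and average: the [d] terms on the right are
    equal by symmetry, and [moment_mixed] evaluates them. *)
Lemma moment_rec k : (k + 1)%:R * moment k = (k + 1 + d)%:R * moment (k + 2).
Proof.
have [ok|ek] := boolP (odd k).
  by rewrite !moment_odd ?mulr0// oddD ok.
have [n ->] : exists n, k = (2 * n)%N.
  by exists k./2; rewrite -[LHS]odd_double_half (negbTE ek) mul2n.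
set B := mean (fun y : T => dotp e0 y ^+ (2 * n) * dotp e1 y ^+ 2).
have hB : (2 * n + 1)%:R * B = moment (2 * n + 2) by exact: moment_mixed.
suff dB : d%:R * B = moment (2 * n) - moment (2 * n + 2).
  have dM : d%:R * moment (2 * n + 2) = (2 * n + 1)%:R * (moment (2 * n) - moment (2 * n + 2)).
    by rewrite -dB -hB; ring.
  by rewrite [(_ + d)%:R]natrD mulrDl dM; ring.
transitivity (\sum_(i < d) mean (fun y : T =>
    dotp e0 y ^+ (2 * n) * dotp (axis (lift ord0 i)) y ^+ 2)).
  rewrite (eq_bigr (fun=> B)); first by rewrite sumr_const card_ord mulr_natl.
  move=> i _; rewrite (@two_point_homogeneous R d (fun a b => a ^+ (2 * n) * b ^+ 2)
    e0 (axis (lift ord0 i)) e0 e1)//; first exact: sphere_axis.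
    by rewrite dotp_pole_equator// dotp_axis tnth_mktuple.
  exact: bmf_monomial.
rewrite -mean_sum; last by move=> i; exact: bmf_monomial.
rewrite -meanB; [|exact: bmf_moment..].
apply: eq_mean => y /sphere_dotp y1.
have {}y1 : tnth y ord0 * tnth y ord0 +
    \sum_(i < d) tnth y (lift ord0 i) * tnth y (lift ord0 i) = 1.
  by rewrite -y1 /dotp big_ord_recl.
rewrite -mulr_sumr exprD -[X in X - _]mulr1 -mulrBr; congr (_ * _).
rewrite -y1 dotp_axis expr2 addrC addKr; apply: eq_bigr => i _.
by rewrite dotp_axis expr2.
Qed.

Lemma moment_even_gt0 n : 0 < moment (2 * n).
Proof.
elim: n => [|n IH]; first by rewrite muln0 moment0 ltr01.
have := moment_rec (2 * n); rewrite mulnS [(2 + _)%N]addnC => h.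
by rewrite -(pmulr_rgt0 _ (_ : 0 < (2 * n + 1 + d)%:R)) -?h ?mulr_gt0// ltr0n addn1.
Qed.

(* If the measure vanished on the cap, the moments would decay geometrically,
   whereas the ratio of consecutive even moments tends to [1]. *)
Lemma cap_gt0 (c : R) : c < 1 -> 0 < mean (fun y : T => (c < dotp e0 y)%R%:R).
Proof.
move=> c1; rewrite lt_neqAle mean_ge0// andbT; apply/eqP => h0.
pose b := Num.max c 0.
have b0 : 0 <= b by rewrite /b le_max lexx orbT.
have b1 : b < 1 by rewrite /b gt_max c1 ltr01.
have bg x : bounded_measurable (fun y : T => (x < dotp e0 y)%R%:R).
  by apply: bmf_gt; have [] := bmf_dotp Se0.
have zb : mean (fun y : T => (b < dotp e0 y)%R%:R) = 0.
  apply/eqP; rewrite eq_le mean_ge0// andbT h0; apply: le_mean => // y _.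
  rewrite ler_nat; have [by_|//] := ltP b (dotp e0 y).
  by rewrite (le_lt_trans _ by_)// /b le_max lexx.
have bgN : bounded_measurable (fun y : T => (b < - dotp e0 y)%R%:R).
  apply: bmf_gt; apply: measurable_funN.
  by have [] := bmf_dotp Se0.
have zbN : mean (fun y : T => (b < - dotp e0 y)%R%:R) = 0.
  by rewrite (@mean_opp_pole (fun t => (b < t)%R%:R))//; exact: bm1_gt.
have key n : moment (2 * n + 2) <= b ^+ 2 * moment (2 * n).
  rewrite -subr_ge0 -meanZ; last exact: bmf_moment.
  rewrite -meanB; [|by apply: bmfZ; exact: bmf_moment|exact: bmf_moment].
  (* Both cap means are zero, so adding them changes nothing but makes the integrand nonnegative:
     where [b < |t|] an added indicator dominates [A * t ^+ 2 <= 1], and elsewhere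
     [t ^+ 2 <= b ^+ 2]. *)
  set X := mean _; rewrite -[X]addr0 -{2}zb -[X + _]addr0 -{2}zbN /X -!meanD//; last 2 first.
  - by apply: bmfD => //; apply: bmfB; [apply: bmfZ|]; exact: bmf_moment.
  - by apply: bmfB; [apply: bmfZ|]; exact: bmf_moment.
  apply: mean_ge0 => y Sy; set t := dotp e0 y.
  have t1 : `|t| <= 1 by exact: dotp_le1.
  have tn : 0 <= t ^+ (2 * n) <= 1.
    rewrite exprM exprn_ge0 ?sqr_ge0//= exprn_ile1 ?sqr_ge0//.
    by rewrite -[t ^+ 2]real_normK ?num_real// expr_le1.
  have t2 : t ^+ 2 <= 1 by rewrite -[t ^+ 2]real_normK ?num_real// expr_le1.
  rewrite exprD; move: (t ^+ (2 * n)) tn => A /andP[A0 A1].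
  have AY : A * t ^+ 2 <= 1 by rewrite mulr_ile1 ?sqr_ge0.
  have BA : 0 <= b ^+ 2 * A by rewrite mulr_ge0 ?sqr_ge0.
  have [bt|tb] := ltP b t; have [bt'|tb'] := ltP b (- t) => /=; try lra.
  have tb2 : t ^+ 2 <= b ^+ 2.
    by rewrite -[t ^+ 2]real_normK ?num_real// lerXn2r ?nnegrE// ler_norml lerNl tb' tb.
  have := ler_wpM2l A0 tb2; lra.
have b2 : 0 < 1 - b ^+ 2 by rewrite subr_gt0 expr_lt1.
(* The recursion and [key] give [(2n + 1) (1 - b^2) <= d b^2 <= d], which this [n] violates. *)
pose n := Num.bound (d%:R / (1 - b ^+ 2)).
have hn : d%:R < n%:R * (1 - b ^+ 2).
  by rewrite -ltr_pdivrMr// archi_boundP// divr_ge0// ltW.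
have Mn := moment_even_gt0 n.
have : (2 * n + 1)%:R * moment (2 * n) <= (2 * n + 1 + d)%:R * (b ^+ 2 * moment (2 * n)).
  by rewrite moment_rec ler_wpM2l.
rewrite mulrA ler_pM2r// !natrD natrM => h.
have : (d%:R : R) * b ^+ 2 <= d%:R by rewrite ler_piMr// -subr_ge0 ltW.
have : (0 : R) <= n%:R * (1 - b ^+ 2) by rewrite mulr_ge0// ltW.
nra.
Qed.

End moments.

(** * Integrals against the weight [(1 - t^2)^c] *)

Section jacobi_weight.
Context {R : realType}.
Local Notation lam := (@lebesgue_measure R).
Local Notation D := (`](-1 : R), 1[%classic : set (measurableTypeR R)).

Definition jacobi (p : {poly R}) (c t : R) : R := p.[t] * (1 - t ^+ 2) `^ c.

Lemma base_gt0 (t : R) : -1 < t < 1 -> 0 < 1 - t ^+ 2.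
Proof. by move=> /andP[t1 t2]; nra. Qed.

Lemma powR_anti (a r s : R) : 0 < a <= 1 -> r <= s -> a `^ s <= a `^ r.
Proof.
move=> /andP[a0 a1] rs.
have -> : s = r + (s - r) by ring.
rewrite powRD; last by rewrite (gt_eqF a0) implybT.
rewrite ler_piMr ?powR_ge0//.
have : a `^ (s - r) <= 1 `^ (s - r).
  by apply: ge0_ler_powR; rewrite ?nnegrE ?subr_ge0 ?ler01// ltW.
by rewrite powR1.
Qed.

Lemma is_derive_horner (p : {poly R}) (t : R) : is_derive t 1 (horner p) p^`().[t].
Proof.
elim/poly_ind: p => [|p c IH].
  rewrite deriv0 horner0 (_ : horner 0 = cst 0); first exact: is_derive_cst.
  by apply/funext => x; rewrite horner0.
rewrite (_ : horner _ = horner p * id + cst c); last first.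
  by apply/funext => x; rewrite hornerMXaddC.
have D1 := is_deriveD (is_deriveM IH (is_derive_id t 1)) (is_derive_cst c t 1).
by apply: (is_derive_eq D1); rewrite derivMXaddC !hornerE /GRing.scale/=; ring.
Qed.

Lemma is_derive_jacobi (p : {poly R}) (c t : R) : -1 < t < 1 ->
  is_derive t 1 (jacobi p c) (jacobi (p^`() * (1 - 'X^2) - (2 * c) *: ('X * p)) (c - 1) t).
Proof.
move=> t1; have b0 := base_gt0 t1.
have D1 : is_derive t 1 (fun x : R => 1 - x ^+ 2) (- (2 * t)).
  rewrite (_ : (fun x => _) = horner (1 - 'X^2 : {poly R})); last first.
    by apply/funext => x; rewrite !hornerE.
  apply: (is_derive_eq (is_derive_horner _ _)).
  by rewrite derivB derivXn derivC !hornerE /= -mulr_natl; ring.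
have D2 := @is_derive1_comp R (@powR R ^~ c) (fun x => 1 - x ^+ 2) t _ _ (is_derive1_powR c b0) D1.
have D3 := is_deriveM (is_derive_horner p t) D2.
apply: (is_derive_eq D3); rewrite /jacobi /GRing.scale/= !hornerE /=.
have -> : (1 - t ^+ 2) `^ c = (1 - t ^+ 2) `^ (c - 1) * (1 - t ^+ 2).
  rewrite -[X in _ = _ * X]powRr1; last exact: ltW.
  by rewrite -powRD ?subrK//; rewrite (gt_eqF b0) implybT.
ring.
Qed.

Lemma FTC_symmetric (f F : R -> R) (b : R) : 0 < b < 1 ->
  (forall t : R, -1 < t < 1 -> derivable f t 1) ->
  (forall t : R, -1 < t < 1 -> is_derive t 1 F (f t)) ->
  (\int[lam]_(t in `[(- b)%R, b]) (f t)%:E = (F b - F (- b))%:E)%E.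
Proof.
move=> /andP[b0 b1] df dF.
have inb t : t \in `[- b, b] -> -1 < t < 1.
  by rewrite in_itv/= => /andP[t1 t2]; apply/andP; split; lra.
have cF t : -1 < t < 1 -> {for t, continuous F}.
  by move=> t1; apply/differentiable_continuous/derivable1_diffP; have [] := dF t t1.
have bb : - b < b by lra.
rewrite EFinB; apply: continuous_FTC2 => //.
- by apply: derivable_within_continuous => t /inb; exact: df.
- split.
  + move=> t /subset_itv_oo_cc /inb t1; by have [] := dF t t1.
  + by apply: cvg_at_right_filter; apply: cF; apply/andP; split; lra.
  + by apply: cvg_at_left_filter; apply: cF; apply/andP; split; lra.
- move=> t /subset_itv_oo_cc /inb t1; rewrite derive1E.
  exact: (@derive_val _ _ _ _ _ _ _ (dF t t1)).
Qed.

(* For [d = 1] the weight is singular at the endpoints, so integrals over [-1, 1]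
   are computed as limits of integrals over [[- cut n, cut n]]. *)
Definition cut (n : nat) : R := 1 - n.+2%:R^-1.

Lemma cut_itv n : 0 < cut n < 1.
Proof.
rewrite /cut subr_gt0 invf_lt1 ?ltr0n// ltr1n /= gtrDl oppr_lt0 invr_gt0 ltr0n//.
Qed.

Lemma cut_cvg : cut n @[n --> \oo] --> (1 : R).
Proof.
rewrite -[X in _ --> X]subr0; apply: cvgB; first exact: cvg_cst.
have := @cvg_harmonic R; rewrite -cvg_shiftS; exact.
Qed.

Definition cutset n : set (measurableTypeR R) := `[- cut n, cut n]%classic.

Lemma measurable_cutset n : measurable (cutset n).
Proof. exact: measurable_itv. Qed.

Lemma cut_nd : {homo cutset : n m / (n <= m)%N >-> (n <= m)%O}.
Proof.
move=> n m nm; apply/subsetPset => x; rewrite /cutset/= !in_itv/= => /andP[x1 x2].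
have : cut n <= cut m.
  by rewrite /cut lerD2l lerN2 lef_pV2 ?posrE ?ltr0n// ler_nat !ltnS.
by move=> h; apply/andP; split; lra.
Qed.

Lemma cut_bigcup : \bigcup_n cutset n = D.
Proof.
apply/seteqP; split => x /=.
  move=> [n _]; rewrite /cutset /= !in_itv/= => /andP[x1 x2].
  have /andP[c0 c1] := cut_itv n; by apply/andP; split; lra.
rewrite in_itv/= => x1; have ax : `|x| < 1 by rewrite ltr_norml.
have [n nx] : exists n, `|x| < cut n.
  have /cvgr_gt := cut_cvg => /(_ `|x| ax)[n _ /(_ n (leqnn n)) h]; by exists n.
exists n => //; rewrite /cutset /= in_itv/= -ler_norml ltW//.
Qed.

Lemma cut_mem n : cutset n `<=` D.
Proof. by rewrite -cut_bigcup; exact: (@bigcup_sup _ _ n). Qed.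

Lemma cut_cvg_integral (f : R -> R) : lam.-integrable D (EFin \o f) ->
  (\int[lam]_(t in cutset n) (f t)%:E @[n --> \oo] -->
   \int[lam]_(t in D) (f t)%:E)%E.
Proof.
move=> intf.
have mD : measurable D by exact: measurable_itv.
have mf : measurable_fun D (EFin \o f) by have /integrableP[] := intf.
pose f_ (n : nat) := (EFin \o f) \_ (cutset n).
have -> : (fun n => \int[lam]_(t in cutset n) (f t)%:E)%E =
    (fun n => \int[lam]_(t in D) f_ n t)%E.
  apply/funext => n; rewrite -integral_mkcondr; congr (integral _ _ _).
  by rewrite setIidr//; exact: cut_mem.
have [] // := @dominated_convergence _ _ R lam D mD f_ (EFin \o f) (fun t => `|(f t)%:E|%E).
- move=> n; apply: (measurable_funS mD (fun _ h => h)).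
  apply/(measurable_restrict _ _ _).1 => //; first exact: measurable_cutset.
  by apply: (measurable_funS mD _ mf) => t [].
- apply/aeW => t Dt; apply: cvg_near_cst.
  move: Dt; rewrite -cut_bigcup => -[n _ tn].
  exists n => // m /= nm; rewrite /f_ patchE mem_set//.
  by have /subsetPset := cut_nd nm; apply.
- exact: integrable_abse.
- apply/aeW => t n Dt; rewrite /f_ patchE; case: ifP => // _.
  by rewrite abse0.
Qed.

Lemma measurable_jacobi p c : measurable_fun setT (jacobi p c).
Proof.
apply: measurable_funM; first by have [] := bm1_horner p.
apply: (measurableT_comp (measurable_powR _)).
by apply: measurable_funB => //; exact: measurable_funX.
Qed.

(** The extremal exponent, attained for [d = 1]. The primitive is [asin], whose increments are at
    most [pi]; larger exponents are dominated by this one because [1 - t^2 <= 1]. *)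
Lemma arcsine_integrable : lam.-integrable D (EFin \o jacobi 1 (- 2^-1)).
Proof.
have mjacobi := measurable_jacobi 1 (- 2^-1).
have p0 t : 0 <= jacobi 1 (- 2^-1) t by rewrite /jacobi hornerC mul1r powR_ge0.
apply/integrableP; split; first exact/measurable_EFinP/measurable_funTS.
apply: (@le_lt_trans _ _ (pi : R)%:E); last exact: ltry.
under eq_integral do rewrite /= ger0_norm//.
have h := @ge0_nondecreasing_set_cvg_integral _ (measurableTypeR R) R
  cutset (EFin \o jacobi 1 (- 2^-1)) lam cut_nd.
rewrite cut_bigcup in h; apply: (cvge_le _ (h measurable_cutset _ _)) => //; last 2 first.
- by move=> n; exact/measurable_EFinP/measurable_funTS.
- by move=> n x _; rewrite lee_fin.
near=> n; have cn := cut_itv n.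
have -> : (\int[lam]_(x in cutset n) (EFin \o jacobi 1 (- 2^-1)) x =
    (asin (cut n) - asin (- cut n))%:E)%E.
  apply: FTC_symmetric => //.
    by move=> t t1; have [] := is_derive_jacobi 1 (- 2^-1) t1.
  move=> t t1; apply: (is_derive_eq (is_derive1_asin t1)).
  by rewrite /jacobi hornerC mul1r powRN powR12_sqrt// ltW// base_gt0.
rewrite lee_fin; have /andP[c0 c1] := cn.
have a1 : asin (cut n) <= pi / 2 by apply: asin_lepi2; apply/andP; split; lra.
have a2 : - (pi / 2) <= asin (- cut n) by apply: asin_geNpi2; apply/andP; split; lra.
lra.
Unshelve. all: by end_near.
Qed.

Lemma jacobi_integrable p c : - 2^-1 <= c -> lam.-integrable D (EFin \o jacobi p c).
Proof.
move=> hc; have [_ [M hM]] := bm1_horner p.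
have M0 : 0 <= M by rewrite (le_trans _ (hM 0 _))// normr0.
have mD : measurable D by exact: measurable_itv.
apply: (le_integrable mD _ _ (integrableZl mD M arcsine_integrable)).
  by apply/measurable_EFinP; apply: measurable_funTS; exact: measurable_jacobi.
move=> t /=; rewrite in_itv/= => t1; rewrite lee_fin /jacobi hornerC mul1r normrM.
have b0 := base_gt0 t1.
rewrite [leRHS]ger0_norm ?mulr_ge0 ?powR_ge0// [X in _ * X]ger0_norm ?powR_ge0//.
rewrite ler_pM ?powR_ge0//; first by apply: hM; rewrite ltW// ltr_norml.
by apply: powR_anti => //; rewrite b0/= gerBl sqr_ge0.
Qed.

Lemma jacobi_endpoint p c : 2^-1 <= c ->
  jacobi p c (cut n) - jacobi p c (- cut n) @[n --> \oo] --> (0 : R).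
Proof.
move=> hc; have [_ [M hM]] := bm1_horner p.
have s0 : (M *+ 2) * Num.sqrt (1 - cut n ^+ 2) @[n --> \oo] --> (0 : R).
  rewrite -[X in _ --> X](mulr0 (M *+ 2)); apply: cvgMr => //.
  rewrite -[X in _ --> X]sqrtr0.
  have -> : (0 : R) = 1 - 1 * 1 by rewrite mulr1 subrr.
  apply: continuous_cvg; first exact: sqrt_continuous.
  apply: cvgB; first exact: cvg_cst.
  by under eq_fun do rewrite expr2; apply: cvgM; exact: cut_cvg.
apply: (squeeze_cvgr _
  (_ : - ((M *+ 2) * Num.sqrt (1 - cut n ^+ 2)) @[n --> \oo] --> (0 : R)) s0); last first.
  by rewrite -oppr0; exact: cvgN.
near=> n; rewrite -ler_norml (le_trans (ler_normB _ _))// mulr2n mulrDl.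
have /andP[c0 c1] := cut_itv n.
have key t : `|t| = cut n -> `|jacobi p c t| <= M * Num.sqrt (1 - cut n ^+ 2).
  move=> tn; have t1 : `|t| < 1 by rewrite tn.
  have t2 : t ^+ 2 = cut n ^+ 2 by rewrite -tn real_normK ?num_real.
  have b0 : 0 < 1 - t ^+ 2 by apply: base_gt0; rewrite -ltr_norml.
  rewrite /jacobi normrM (ger0_norm (powR_ge0 _ _)) ler_pM ?powR_ge0//.
    by apply: hM; exact: ltW.
  rewrite -powR12_sqrt -?t2; last exact: ltW.
  by apply: powR_anti => //; rewrite b0/= gerBl sqr_ge0.
by apply: lerD; apply: key; rewrite ?normrN ger0_norm// ltW.
Unshelve. all: by end_near.
Qed.

(** The integrand is the derivative of [p (1 - t^2)^c], whose boundary terms vanish in the limit.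
    With [c = d / 2] and [p = 'X^(k + 1)] it yields the recursion of [moment_rec]. *)
Lemma jacobi_integral_derive p c : 2^-1 <= c ->
  (\int[lam]_(t in D)
    (jacobi (p^`() * (1 - 'X^2) - (2 * c) *: ('X * p)) (c - 1) t)%:E = 0)%E.
Proof.
move=> hc; set q := _ - _.
have iq : lam.-integrable D (EFin \o jacobi q (c - 1)) by apply: jacobi_integrable; lra.
have h := cut_cvg_integral iq.
have E n : (\int[lam]_(t in cutset n) (jacobi q (c - 1) t)%:E =
    (jacobi p c (cut n) - jacobi p c (- cut n))%:E)%E.
  apply: FTC_symmetric; first exact: cut_itv.
    by move=> t t1; have [] := is_derive_jacobi q (c - 1) t1.
  by move=> t t1; exact: is_derive_jacobi.
have h2 : ((jacobi p c (cut n) - jacobi p c (- cut n))%:E @[n --> \oo] --> 0%:E)%E.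
  by apply: cvg_EFin; [exact: nearW|exact: jacobi_endpoint].
rewrite (funext E) in h.
by apply: (cvg_unique _ h h2); exact: ereal_hausdorff.
Qed.

Lemma jacobi1_integral_gt0 c : (0 < \int[lam]_(t in D) (jacobi 1 c t)%:E)%E.
Proof.
rewrite lt_neqAle integral_ge0 ?andbT; last first.
  by move=> t _; rewrite lee_fin /jacobi hornerC mul1r powR_ge0.
apply/eqP => h.
have mD : measurable D by exact: measurable_itv.
have : (\int[lam]_(t in D) `|(jacobi 1 c t)%:E| = 0)%E.
  rewrite [RHS]h; apply: eq_integral => t _; rewrite gee0_abs//.
  by rewrite lee_fin /jacobi hornerC mul1r powR_ge0.
move=> /(ae_eq_integral_abs lam mD)[].
  by apply/measurable_EFinP; apply: measurable_funTS; exact: measurable_jacobi.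
move=> N [mN N0 subN].
have : (lam D <= lam N)%E.
  apply: le_measure; rewrite ?inE//.
  move=> t Dt; apply: subN => /= /(_ Dt) [] /eqP.
  move: Dt; rewrite /= in_itv/= => /base_gt0/gt_eqF b0.
  by rewrite /jacobi hornerC mul1r powR_eq0 b0.
rewrite N0 lebesgue_measure_itv/= lte_fin ifT; last lra.
by rewrite -EFinB lee_fin; apply/negP; rewrite -ltNge; lra.
Qed.

End jacobi_weight.

(** * Legendre polynomials as zonal functions *)

Section legendre.
Context {R : realType}.
Variable d : nat.
Hypothesis d_ge1 : (1 <= d)%N.
Local Notation T := (d.+1.-tuple R).
Local Notation S := (sphere d : set T).
Local Notation e0 := (@pole R d).
Local Notation lam := (@lebesgue_measure R).
Local Notation D := (`](-1 : R), 1[%classic : set (measurableTypeR R)).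
Local Notation c := ((d%:R / 2 : R) - 1).

Definition weighted (p : {poly R}) : R := \int[lam]_(t in D) jacobi p c t.

Let half_le : 2^-1 <= d%:R / 2 :> R.
Proof. by rewrite ler_pdivlMr// mulVf// ler1n. Qed.

Let iw p : lam.-integrable D (EFin \o jacobi p c).
Proof. by apply: jacobi_integrable; have := half_le; lra. Qed.

Lemma weightedD p q : weighted (p + q) = weighted p + weighted q.
Proof.
rewrite /weighted -RintegralD//.
by apply: eq_Rintegral => t _; rewrite /jacobi hornerD mulrDl.
Qed.

Lemma weightedZ a p : weighted (a *: p) = a * weighted p.
Proof.
rewrite /weighted -RintegralZl//.
by apply: eq_Rintegral => t _; rewrite /jacobi hornerZ mulrA.
Qed.

Lemma weighted_derive p :
  weighted (p^`() * (1 - 'X^2) - d%:R *: ('X * p)) = 0.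
Proof.
have := jacobi_integral_derive p half_le.
rewrite (_ : 2 * (d%:R / 2) = d%:R) ?[2 * _]mulrC ?divfK// => h.
by rewrite /weighted /Rintegral h.
Qed.

Lemma weighted_rec k :
  (k + 1)%:R * weighted 'X^k = (k + 1 + d)%:R * weighted 'X^(k + 2).
Proof.
have := weighted_derive 'X^(k + 1).
have -> : ('X^(k + 1))^`() * (1 - 'X^2) - d%:R *: ('X * 'X^(k + 1)) =
    (k + 1)%:R *: 'X^k + (- (k + 1 + d)%:R) *: 'X^(k + 2) :> {poly R}.
  rewrite derivXn addn1 /= -!mul_polyC -mulr_natl natrD rmorphN rmorphD/= !rmorph_nat.
  by rewrite -exprS addn2 !exprS; ring.
by rewrite weightedD !weightedZ mulNr => /eqP; rewrite subr_eq0 => /eqP.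
Qed.

(** Both sides obey the same two-step recursion, so the values at [k = 0] and [k = 1] decide. *)
Lemma weighted_Xn k : weighted 'X^k = weighted 1 * moment d k.
Proof.
have [n] := ubnP k; elim: n k => // n IH [|[|k]] kn.
- by rewrite expr0 moment0 mulr1.
- rewrite moment_odd// mulr0.
  have := weighted_derive 1.
  rewrite derivC mul0r sub0r mulr1 -scaleNr weightedZ => /eqP.
  by rewrite mulf_eq0 oppr_eq0 pnatr_eq0 (gtn_eqF d_ge1)/= => /eqP; rewrite expr1.
- have := weighted_rec k; have := @moment_rec R d d_ge1 k.
  rewrite IH; last by rewrite -ltnS ltnW.
  rewrite -[k.+2]addn2 => hM hw.
  have n0 : (k + 1 + d)%:R != 0 :> R by rewrite pnatr_eq0 addn1.
  by apply: (mulfI n0); rewrite -hw mulrCA hM; ring.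
Qed.

Lemma weighted_mean p : weighted p = weighted 1 * mean (fun y : T => p.[dotp e0 y]).
Proof.
have -> : (fun y : T => p.[dotp e0 y]) = (fun y => \sum_(k < size p) p`_k * dotp e0 y ^+ k).
  by apply/funext => y; rewrite horner_coef.
have Se0 : S e0 by exact: sphere_pole.
rewrite mean_sum; last by move=> k; apply: bmfZ; exact: bmf_moment.
rewrite mulr_sumr -[in LHS](coefK p) poly_def.
have w0 : weighted 0 = 0 by rewrite -(scale0r 0) weightedZ mul0r.
rewrite (big_morph weighted weightedD w0); apply: eq_bigr => k _.
rewrite weightedZ weighted_Xn mulrCA; congr (_ * _).
by rewrite -meanZ//; exact: bmf_moment.
Qed.

Lemma weighted1_neq0 : weighted 1 != 0.
Proof.
have h := @jacobi1_integral_gt0 R c.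
have hf : (\int[lam]_(t in D) (jacobi 1 c t)%:E)%E \is a fin_num.
  by apply: integrable_fin_num => //; exact: iw.
by rewrite /weighted /Rintegral gt_eqF// fine_gt0// h ltey_eq hf.
Qed.

Lemma legendre_mean (p : {poly R}) :
  (\int[lam]_(t in `[(-1)%R, 1%R]) (p.[t] * legendre_weight d t)%:E = 0)%E ->
  mean (fun y : T => p.[dotp e0 y]) = 0.
Proof.
have cE : (d%:R - 2) / 2 = c by rewrite mulrBl divff.
have E : (fun t => p.[t] * legendre_weight d t) = jacobi p c.
  by apply/funext => t; rewrite /jacobi /legendre_weight cE.
move=> h; have : weighted p = 0.
  rewrite /weighted /Rintegral -(@integral_itv_bndoo R (-1) 1 _ true false); last first.
    by apply/measurable_EFinP; apply: measurable_funTS; exact: measurable_jacobi.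
  by rewrite -E h.
by rewrite weighted_mean => /eqP; rewrite mulf_eq0 (negbTE weighted1_neq0) => /eqP.
Qed.

(** By their degrees, [P 0], ..., [P (n - 1)] span the polynomials of size at most [n]; the
    induction removes one leading coefficient at a time. *)
Lemma legendre_ortho (P : nat -> {poly R}) : generalised_legendre d P ->
  forall n (p : {poly R}), (size p <= n)%N ->
  mean (fun y : T => (P n).[dotp e0 y] * p.[dotp e0 y]) = 0.
Proof.
move=> [sP oP _] n p pn.
have bh q : bounded_measurable (fun y : T => horner q (dotp e0 y)).
  by apply: bmf_zonal; [exact: bm1_horner|exact: sphere_pole].
suff H (k : nat) (q : {poly R}) : (k <= n)%N -> (size q <= k)%N ->
    mean (fun y : T => (P n).[dotp e0 y] * q.[dotp e0 y]) = 0 by exact: (H n).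
elim: k q => [|k IH] q kn.
  rewrite leqn0 size_poly_eq0 => /eqP ->.
  by under eq_fun do rewrite horner0 mulr0; rewrite mean_cst.
move=> qk; pose a := q`_k / (P k)`_k; pose g := q - a *: P k.
have Pk0 : (P k)`_k != 0.
  have -> : (P k)`_k = lead_coef (P k) by rewrite lead_coefE sP.
  by rewrite lead_coef_eq0 -size_poly_eq0 sP.
have gk : (size g <= k)%N.
  apply/leq_sizeP => j; rewrite leq_eqVlt => /predU1P[<-|kj]; rewrite /g coefB coefZ.
    by rewrite /a divfK ?subrr.
  by rewrite !nth_default ?sP// ?mulr0 ?subr0// (leq_trans qk).
have Pnk : mean (fun y : T => (P n).[dotp e0 y] * (P k).[dotp e0 y]) = 0.
  have nk : n <> k by move=> nk; rewrite nk ltnn in kn.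
  have := oP n k nk; under eq_integral do rewrite -hornerM.
  by move=> /legendre_mean <-; apply: eq_mean => y _; rewrite hornerM.
transitivity (mean (fun y : T => (P n).[dotp e0 y] * g.[dotp e0 y] +
    a * ((P n).[dotp e0 y] * (P k).[dotp e0 y]))).
  apply: eq_mean => y _; have -> : q.[dotp e0 y] = g.[dotp e0 y] + a * (P k).[dotp e0 y].
    by rewrite -hornerZ -hornerD /g subrK.
  by ring.
rewrite meanD; [|by apply: bmfM|by apply: bmfZ; apply: bmfM].
by rewrite meanZ ?Pnk ?mulr0 ?addr0; [exact: IH (ltnW kn) gk|apply: bmfM].
Qed.

End legendre.

(** * The number variance controls the Legendre sums *)

Section variance.
Context {R : realType}.
Variable d : nat.
Hypothesis d_ge1 : (1 <= d)%N.
Local Notation T := (d.+1.-tuple R).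
Local Notation S := (sphere d : set T).
Local Notation mu := (@surface R d).
Local Notation e0 := (@pole R d).

Definition cap_mean (c : R) : R := mean (fun y : T => (c < dotp e0 y)%R%:R).

Let Se0 : S e0. Proof. exact: sphere_pole. Qed.

Lemma cap_meanE x c : S x -> mean (fun y : T => (c < dotp x y)%R%:R) = cap_mean c.
Proof.
move=> Sx; have [w Sw xw] := exists_orthogonal d_ge1 Sx.
apply: (@two_point_homogeneous R d (fun s _ => (c < s)%R%:R) x w e0 (@equator R d)) => //.
- exact: sphere_equator.
- by rewrite xw dotp_pole_equator.
- exact: (bmf_zonal (bm1_gt c) Se0).
Qed.

Lemma surface_cap x phi : S x -> fine (mu (cap x phi)) = cap_mean (cos phi).
Proof.
move=> Sx; rewrite -(cap_meanE _ Sx).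
have mc : measurable ((fun y : T => dotp x y) @^-1` `]cos phi, +oo[).
  by apply: measurable_preimage => //; have [] := bmf_dotp Sx.
rewrite (_ : cap x phi = (fun y : T => dotp x y) @^-1` `]cos phi, +oo[ `&` S); last first.
  by apply/seteqP; split => y; rewrite /cap /= in_itv/= andbT => -[].
rewrite -mean_indic//; apply: eq_mean => y Sy; rewrite indicE; congr (nat_of_bool _)%:R.
by apply/idP/idP; rewrite inE/= in_itv/= andbT.
Qed.

Lemma npoints_cap N (X : 'I_N -> T) x phi : (forall i, S (X i)) ->
  (npoints X (cap x phi))%:R = \sum_(i < N) (cos phi < dotp x (X i))%R%:R :> R.
Proof.
move=> SX; rewrite /npoints -sum1_card natr_sum big_mkcond/=; apply: eq_bigr => i _.
rewrite (_ : i \in _ = (cos phi < dotp x (X i))%R); first by case: (_ < _).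
by rewrite inE; apply/idP/idP; rewrite inE /cap/=; [case|].
Qed.

(** The symmetry of [dotp] lets the points serve as cap centres, so each term is a zonal function
    about [X i], ready for Funk-Hecke. *)
Definition discrepancy N (X : 'I_N -> T) (phi : R) (y : T) : R :=
  \sum_(i < N) (cos phi < dotp (X i) y)%R%:R - N%:R * cap_mean (cos phi).

Lemma bmf_discrepancy N (X : 'I_N -> T) phi : (forall i, S (X i)) ->
  bounded_measurable (discrepancy X phi).
Proof.
move=> SX; apply: bmfB; last exact: bmf_cst.
by apply: bmf_sum => i; exact: (bmf_zonal (bm1_gt _) (SX i)).
Qed.

Lemma number_varianceE N (X : 'I_N -> T) phi : (forall i, S (X i)) ->
  number_variance X phi = mean (fun y => discrepancy X phi y ^+ 2).
Proof.
move=> SX; apply: eq_mean => y Sy; rewrite surface_cap// npoints_cap//.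
by congr ((_ - _) ^+ 2); apply: eq_bigr => i _; rewrite dotpC.
Qed.

Lemma mean_sqr_le f g : bounded_measurable f -> bounded_measurable g ->
  mean (fun y : T => f y * g y) ^+ 2 <=
  mean (fun y => f y ^+ 2) * mean (fun y => g y ^+ 2).
Proof.
move=> bf bg; set A := mean (fun y => f y ^+ 2); set B := mean (fun y => g y ^+ 2).
set C := mean _.
have bff := bmfX 2 bf; have bgg := bmfX 2 bg; have bfg := bmfM bf bg.
have h s t : 0 <= s ^+ 2 * A + 2 * s * t * C + t ^+ 2 * B.
  rewrite -!meanZ// -!meanD//; try by [apply: bmfZ|apply: bmfD; apply: bmfZ].
  apply: mean_ge0 => y _.
  by rewrite (_ : _ + _ = (s * f y + t * g y) ^+ 2) ?sqr_ge0//; ring.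
have A0 : 0 <= A by apply: mean_ge0 => y _; exact: sqr_ge0.
have B0 : 0 <= B by apply: mean_ge0 => y _; exact: sqr_ge0.
have [B00|Bn] := eqVneq B 0.
  have [C0|Cn] := eqVneq C 0; first by rewrite C0 expr0n mulr_ge0.
  (* With [B = 0] the form is affine in [t], and this [t] gives it the value [-1]. *)
  have := h 1 (- (A + 1) / (2 * C)); rewrite B00 mulr0 addr0 expr1n mul1r mulr1.
  have -> : 2 * (- (A + 1) / (2 * C)) * C = - (A + 1) by field.
  lra.
have Bp : 0 < B by rewrite lt_neqAle eq_sym Bn.
have := h B (- C).
have -> : B ^+ 2 * A + 2 * B * - C * C + (- C) ^+ 2 * B = B * (A * B - C ^+ 2) by ring.
by rewrite pmulr_rge0// subr_ge0.
Qed.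

Lemma legendre_sum_bound (P : {poly R}) (n N : nat) (X : 'I_N -> T) (phi : R) :
  size P = n.+2 -> P.[1] = 1 -> (forall i, S (X i)) ->
  (forall p : {poly R}, (size p <= n.+1)%N ->
    mean (fun y : T => P.[dotp e0 y] * p.[dotp e0 y]) = 0) ->
  0 <= mean (fun y : T => (cos phi < dotp e0 y)%R%:R * P.[dotp e0 y]) ^+ 2 *
       (\sum_(i < N) \sum_(j < N) P.[dotp (X i) (X j)])
    <= number_variance X phi.
Proof.
move=> sP P1 SX oP; set a := mean _; set f := fun t : R => (cos phi < t)%R%:R : R.
have bP x : S x -> bounded_measurable (fun y : T => P.[dotp x y]).
  by apply: bmf_zonal; exact: bm1_horner.
have bf x : S x -> bounded_measurable (fun y : T => f (dotp x y)).
  by apply: bmf_zonal; exact: bm1_gt.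
have e00 : dotp e0 e0 = 1 by apply/sphere_dotp.
set l := mean (fun y : T => P.[dotp e0 y] * P.[dotp e0 y]).
have l0 : 0 < l.
  rewrite lt_neqAle mean_ge0 ?andbT; last by move=> y _; rewrite -expr2 sqr_ge0.
  apply/eqP => l0; have : P = 0.
    by apply: (zonal_definite d_ge1); rewrite -[RHS]/(0 : R) l0;
      apply: eq_mean => y _; rewrite expr2.
  by move=> P0; move: sP; rewrite P0 size_poly0.
have FP x z : S x -> S z ->
    mean (fun y : T => P.[dotp x y] * P.[dotp z y]) = l * P.[dotp x z].
  by move=> Sx Sz; apply: (Funk_Hecke d_ge1 sP P1 (bm1_horner P) oP).
have Ff x z : S x -> S z ->
    mean (fun y : T => f (dotp x y) * P.[dotp z y]) = a * P.[dotp x z].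
  by move=> Sx Sz; apply: (Funk_Hecke d_ge1 sP P1 (bm1_gt (cos phi)) oP).
(* Positive degree makes [P] orthogonal to constants, so the term [N sigma(C)] of the discrepancy
   drops out. *)
have EP z : S z -> mean (fun y : T => P.[dotp z y]) = 0.
  move=> Sz; have s1 : (size (1 : {poly R})%R <= n.+1)%N by rewrite size_poly1.
  rewrite -(zonal_ortho d_ge1 oP s1 Sz Se0); apply: eq_mean => y _.
  by rewrite hornerC mulr1.
pose s z := \sum_(i < N) P.[dotp (X i) z].
have bs : bounded_measurable s by apply: bmf_sum => i; apply: bP; exact: SX.
have Es : mean (fun z => s z ^+ 2) = l * \sum_(i < N) \sum_(j < N) P.[dotp (X i) (X j)].
  transitivity (mean (fun z : T => \sum_(i < N) \sum_(j < N) P.[dotp (X i) z] * P.[dotp (X j) z])).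
    apply: eq_mean => z _; rewrite /s expr2 mulr_suml; apply: eq_bigr => i _.
    by rewrite mulr_sumr.
  have bij i j : bounded_measurable (fun z : T => P.[dotp (X i) z] * P.[dotp (X j) z]).
    by apply: bmfM; apply: bP; exact: SX.
  rewrite mean_sum; last by move=> i; apply: bmf_sum => j; exact: bij.
  rewrite mulr_sumr; apply: eq_bigr => i _; rewrite mean_sum; last by move=> j; exact: bij.
  by rewrite mulr_sumr; apply: eq_bigr => j _; exact: FP.
have bD := bmf_discrepancy phi SX.
have as_ z : S z -> a * s z = mean (fun y => discrepancy X phi y * P.[dotp z y]).
  move=> Sz; have bfP (i : 'I_N) :
      bounded_measurable (fun y : T => f (dotp (X i) y) * P.[dotp z y]).
    by apply: bmfM; [apply: bf; exact: SX|exact: bP].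
  transitivity (mean (fun y : T => \sum_(i < N) f (dotp (X i) y) * P.[dotp z y]
      - (N%:R * cap_mean (cos phi)) * P.[dotp z y])).
    rewrite meanB; [|exact: bmf_sum|by apply: bmfZ; exact: bP].
    rewrite meanZ; last exact: bP.
    rewrite EP// mulr0 subr0 mean_sum// /s mulr_sumr.
    by apply: eq_bigr => i _; rewrite Ff.
  by apply: eq_mean => y _; rewrite /discrepancy mulrBl mulr_suml.
have sb z : S z -> a ^+ 2 * s z ^+ 2 <= number_variance X phi * l.
  move=> Sz; rewrite -exprMn as_// number_varianceE//.
  rewrite (le_trans (mean_sqr_le bD (bP z Sz)))// le_eqVlt; apply/orP; left; apply/eqP.
  congr (_ * _); have <- : l * P.[dotp z z] = l by rewrite (sphere_dotp z).1// P1 mulr1.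
  by rewrite -FP//; apply: eq_mean => y _; rewrite expr2.
have S0 : 0 <= \sum_(i < N) \sum_(j < N) P.[dotp (X i) (X j)].
  rewrite -(pmulr_rge0 _ l0) -Es; apply: mean_ge0 => z _; exact: sqr_ge0.
apply/andP; split; first by rewrite mulr_ge0// sqr_ge0.
(* Averaging [sb] over [z] gives [a^2 E s^2 <= V l]; since [E s^2] is [l] times the double sum, [l]
   cancels. *)
rewrite -(ler_pM2r l0) -mulrA [_ * l]mulrC -Es -meanZ; last exact: bmfX.
rewrite -[leRHS](@mean_cst R d); apply: le_mean => //.
- by apply: bmfZ; exact: bmfX.
- exact: bmf_cst.
Qed.

Lemma acos_itv (c : R) : 0 < c < 1 -> 0 < acos c < pi / 2 /\ cos (acos c) = c.
Proof.
move=> /andP[c0 c1]; have cK : cos (acos c) = c.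
  by apply: acosK; rewrite in_itv/=; apply/andP; split; lra.
split => //; apply/andP; split; first by apply: acos_gt0; apply/andP; split; lra.
have p0 := pi_gt0 R.
rewrite -ltr_cos ?cK ?cos_pihalf// in_itv/=; last by apply/andP; split; lra.
by rewrite acos_ge0 ?acos_lepi//; apply/andP; split; lra.
Qed.

Lemma exists_cap (P : {poly R}) : P.[1] = 1 ->
  exists2 phi : R, 0 < phi < pi / 2 &
    mean (fun y : T => (cos phi < dotp e0 y)%R%:R * P.[dotp e0 y]) != 0.
Proof.
move=> P1; have /(_ (ball (P.[1]) (2^-1 : R))) : continuous_at (1 : R) (horner P).
  exact: continuous_horner.
move=> /(_ (nbhsx_ballx _ _ (ltac:(by rewrite invr_gt0 ltr0n) : 0 < (2^-1 : R)))).
move=> /nbhs_ballP[r /= r0 hr].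
(* The first bound keeps the cap where [P > 1 / 2], the second makes its radius less than
   [pi / 2]. *)
pose c := Num.max (1 - r / 2) 2^-1.
have c1 : c < 1 by rewrite /c gt_max; apply/andP; split; lra.
have c0 : 0 < c by rewrite /c lt_max; apply/orP; right; lra.
have [phi_itv cK] := acos_itv (ltac:(by rewrite c0 c1) : 0 < c < 1).
exists (acos c) => //; rewrite cK gt_eqF//.
have bc : bounded_measurable (fun y : T => (c < dotp e0 y)%R%:R) := bmf_zonal (bm1_gt c) Se0.
apply: (@lt_le_trans _ _ (2^-1 * cap_mean c)).
  by rewrite mulr_gt0// ?invr_gt0 ?ltr0n// cap_gt0.
rewrite /cap_mean -meanZ//; apply: le_mean.
- exact: bmfZ.
- by apply: bmfM => //; exact: (bmf_zonal (bm1_horner P) Se0).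
move=> y Sy; have [cy|] := ltP c (dotp e0 y); last by rewrite mulr0 mul0r.
rewrite mulr1 mul1r.
have y1 : dotp e0 y <= 1 by rewrite (le_trans (ler_norm _))// dotp_le1.
have cr : 1 - r / 2 <= c by rewrite /c le_max lexx.
have : ball P.[1] 2^-1 P.[dotp e0 y].
  apply: hr; rewrite /ball/= ger0_norm; lra.
by rewrite P1 /ball/= ltr_norml => /andP[_ h]; lra.
Qed.

End variance.

(** * Hyperuniformity implies uniform distribution *)

Section uniform.
Context {R : realType}.
Variable d : nat.
Hypothesis d_ge1 : (1 <= d)%N.
Local Notation T := (d.+1.-tuple R).
Local Notation S := (sphere d : set T).
Local Notation mu := (@surface R d).
Local Notation e0 := (@pole R d).

Let Se0 : S e0. Proof. exact: sphere_pole. Qed.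

(** The hypotheses give [|x - y|^2 = 2 - 2 <x, y> < delta^2], and a unit vector [z] cannot separate
    [x] and [y] by more than their distance. *)
Lemma dotp_chord (x y z : T) (c delta : R) : S x -> S y -> S z -> 0 < delta ->
  1 - delta ^+ 2 / 2 <= c -> c < dotp x y -> dotp z x <= dotp z y + delta.
Proof.
move=> /sphere_dotp Sx /sphere_dotp Sy /sphere_dotp Sz d0 cd cxy.
(* The vector is the component of [x - y] orthogonal to [z], so its square length is
   [|x - y|^2 - <z, x - y>^2]. *)
have := dotp_ge0 (axpy (dotp z y - dotp z x) z (axpy (-1) y x)).
rewrite !(dotp_axpy, dotpC _ (axpy _ _ _)).
rewrite [dotp y x]dotpC [dotp x z]dotpC [dotp y z]dotpC Sx Sy Sz => h.
have {}h : (dotp z x - dotp z y) ^+ 2 <= delta ^+ 2 by nra.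
by rewrite leNgt; apply/negP => h'; nra.
Qed.

(** The bands [A n] around height [c] shrink into a null level set, so their measures tend to
    zero. *)
Lemma cap_mean_continuous (c e : R) : 0 < e ->
  exists2 delta, 0 < delta &
    cap_mean d (c - delta) <= cap_mean d c + e /\ cap_mean d c - e <= cap_mean d (c + delta).
Proof.
move=> e_gt0.
pose h (n : nat) : R := n.+1%:R^-1.
have h0 n : 0 < h n by rewrite invr_gt0 ltr0n.
pose A n : set T := S `&` (fun y => dotp e0 y) @^-1` `]c - h n, c + h n].
have mA n : measurable (A n).
  apply: measurableI => //; apply: measurable_preimage => //.
  by have [] := bmf_dotp Se0.
have ndA : {homo A : n m / (n <= m)%N >-> (m <= n)%O}.
  move=> n m nm; apply/subsetPset => y [Sy]; rewrite /= !in_itv/= => /andP[y1 y2].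
  split => //; rewrite /= in_itv/=.
  have : h m <= h n by rewrite /h lef_pV2 ?posrE ?ltr0n// ler_nat ltnS.
  by move=> hh; apply/andP; split; lra.
have capA : \bigcap_n A n `<=` level e0 c.
  move=> y Ay; split; first by have [] := Ay 0%N I.
  apply/eqP; rewrite -subr_eq0 -normr_le0; apply/ler_addgt0Pr => r r0; rewrite add0r.
  have [_ [n _ /(_ n (leqnn n)) hn]] := (I, cvgr_lt _ (@cvg_harmonic R) _ r0).
  have [_] := Ay n I; rewrite /= in_itv/= => /andP[y1 y2].
  rewrite /harmonic/= -/(h n) in hn.
  by rewrite ler_norml; apply/andP; split; lra.
have mcA : measurable (\bigcap_n A n) by exact: bigcap_measurable.
have mu0 : mu (\bigcap_n A n) = 0%E.
  apply/eqP; rewrite eq_le measure_ge0 andbT -(level_null d_ge1 c Se0).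
  by apply: le_measure => //; rewrite ?inE//; exact: measurable_level.
have muA : (mu (A 0%N) < +oo)%E.
  by rewrite (le_lt_trans (probability_le1 _ _))// ltry.
have : (mu \o A) n @[n --> \oo] --> (0%:E : \bar R).
  by have <- : mu (\bigcap_n A n) = 0%:E := mu0; exact: nonincreasing_cvg_mu.
move=> /fine_cvgP[_ /cvgrPdist_le/(_ e e_gt0)[n _ /(_ n (leqnn n))]].
rewrite sub0r normrN /= => hn.
have An : mean (\1_(A n)) <= e.
  rewrite mean_indic// setIidl; last by move=> y [].
  by rewrite (le_trans (ler_norm _)).
have bg x : bounded_measurable (fun y : T => (x < dotp e0 y)%R%:R) := bmf_zonal (bm1_gt x) Se0.
have key x y : c - h n <= x -> y <= c + h n -> x <= y -> cap_mean d x <= cap_mean d y + e.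
  move=> cx cy xy; rewrite -lerBlDl (le_trans _ An)// -meanB//.
  apply: le_mean; [exact: bmfB|exact: bmf_indic|].
  move=> t St; have [xt|tx] := ltP x (dotp e0 t); have [yt|ty] := ltP y (dotp e0 t) => /=;
    rewrite ?subrr ?subr0 ?sub0r ?indicE ?ler0n//.
    rewrite mem_set//; split => //; rewrite /= in_itv/=; apply/andP; split; lra.
  by rewrite (le_trans _ (ler0n _ _))// oppr_le0.
exists (h n) => //; have hn0 := h0 n.
by split; [|rewrite lerBlDr]; apply: key; lra.
Qed.

(* Pairing the discrepancy with the indicator [g] of a slightly larger (smaller)
   cap: a point inside the original cap contributes the full mass of its small cap
   to [E (discrepancy * g)] (a point outside contributes nothing). *)
Lemma count_bounds N (X : 'I_N -> T) (phi tau c c1 c2 : R) (z : T) :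
  (forall i, S (X i)) -> S z -> 0 < tau -> number_variance X phi <= tau ^+ 2 ->
  (forall i y, S y -> cos phi < dotp (X i) y ->
     (c < dotp z (X i) -> c1 < dotp z y) /\ (c2 < dotp z y -> c < dotp z (X i))) ->
  cap_mean d (cos phi) * (\sum_(i < N) (c < dotp z (X i))%R%:R - N%:R * cap_mean d c1) <= tau /\
  - tau <= cap_mean d (cos phi) * (\sum_(i < N) (c < dotp z (X i))%R%:R - N%:R * cap_mean d c2).
Proof.
move=> SX Sz t0 Vt Hi; set a := cap_mean d (cos phi).
pose f t : R := (cos phi < t)%R%:R.
pose g b (y : T) : R := (b < dotp z y)%R%:R.
have bg b : bounded_measurable (g b) := bmf_zonal (bm1_gt b) Sz.
have bf i : bounded_measurable (fun y : T => f (dotp (X i) y)) :=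
  bmf_zonal (bm1_gt (cos phi)) (SX i).
have bD := bmf_discrepancy phi SX.
(* Cauchy-Schwarz with [E g^2 <= 1]. *)
have small b : - tau <= mean (fun y => discrepancy X phi y * g b y) <= tau.
  rewrite -ler_norml -[leRHS]ger0_norm ?(ltW t0)// -(ler_pXn2r (n := 2))// ?nnegrE//.
  rewrite !real_normK ?num_real// (le_trans (mean_sqr_le bD (bg b)))// -number_varianceE//.
  rewrite -[leRHS]mulr1 ler_pM//.
  - by rewrite number_varianceE//; apply: mean_ge0 => y _; exact: sqr_ge0.
  - by apply: mean_ge0 => y _; exact: sqr_ge0.
  rewrite -[leRHS](@mean_cst R d); apply: le_mean; [exact: bmfX|exact: bmf_cst|].
  by move=> y _; rewrite /g; case: (_ < _); rewrite ?expr1n ?expr0n ?ler01.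
have expand b : mean (fun y => discrepancy X phi y * g b y) =
    \sum_(i < N) mean (fun y : T => f (dotp (X i) y) * g b y) - N%:R * a * cap_mean d b.
  rewrite -(cap_meanE d_ge1 b Sz) -meanZ; last exact: bg.
  rewrite -mean_sum; last by move=> i; exact: bmfM.
  rewrite -meanB; [|by apply: bmf_sum => i; exact: bmfM (bf i) (bg b)|by apply: bmfZ; exact: bg].
  by apply: eq_mean => y _; rewrite /discrepancy mulrBl mulr_suml.
have Ef i : mean (fun y : T => f (dotp (X i) y)) = a by exact: cap_meanE.
split.
  have /andP[_] := small c1; apply: le_trans; rewrite expand mulrBr mulrCA mulrA lerB//.
  rewrite mulr_sumr; apply: ler_sum => i _.
  have [ci|_] := ltP c (dotp z (X i)); last first.
    by rewrite mulr0; apply: mean_ge0 => y _; rewrite mulr_ge0// ler0n.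
  rewrite mulr1 -(Ef i); apply: le_mean; [exact: bf|exact: bmfM|].
  move=> y Sy; rewrite /f; have [iy|_] := ltP (cos phi) (dotp (X i) y); last by rewrite mul0r.
  by rewrite mul1r /g ((Hi i y Sy iy).1 ci).
have /andP[+ _] := small c2; move=> /le_trans; apply; rewrite expand mulrBr mulrCA mulrA lerB//.
rewrite mulr_sumr; apply: ler_sum => i _.
have [ci|ic] := ltP c (dotp z (X i)).
  rewrite mulr1 -(Ef i); apply: le_mean; [exact: bmfM|exact: bf|].
  move=> y Sy; rewrite ler_piMr ?ler0n// /g.
  by case: (_ < _); rewrite ?ler01.
rewrite mulr0 -[leRHS](@mean_cst R d); apply: le_mean; [exact: bmfM|exact: bmf_cst|].
move=> y Sy; rewrite /f /g; have [iy|_] := ltP (cos phi) (dotp (X i) y); last by rewrite mul0r.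
have [c2y|_] := ltP c2 (dotp z y); last by rewrite mulr0.
by have := (Hi i y Sy iy).2 c2y; rewrite ltNge ic.
Qed.

End uniform.

Theorem theorem1 (R : realType) (d : nat) (d_ge1 : (1 <= d)%N)
    (X : forall N : nat, 'I_N -> d.+1.-tuple R)
    (X_sphere : forall (N : nat) (i : 'I_N), sphere d (X N i))
    (X_card : forall N : nat, injective (X N))
    (X_hyperuniform : hyperuniform_large_caps X) :
  (forall P : nat -> {poly R}, generalised_legendre d P ->
     forall n : nat, (1 <= n)%N ->
       (fun N : nat => N%:R^-1 *
          \sum_(i < N) \sum_(j < N) (P n).[dotp (X N i) (X N j)] : R) @ \oo
         --> (0 : R))
  /\ uniformly_distributed X.
Proof.
have small phi : 0 < phi < pi / 2 -> forall e, 0 < e ->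
    \forall N \near \oo, number_variance (X N) phi <= e * N%:R.
  move=> phi_itv e e0; have /eqoP/(_ e e0) := X_hyperuniform phi phi_itv.
  apply: filterS => N; rewrite [`|_%:R|]ger0_norm ?ler0n//.
  exact/le_trans/ler_norm.
split.
  move=> P LP [//|n] _; have [sP oP P1] := LP.
  have [phi phi_itv a0] := exists_cap d_ge1 (P1 n.+1).
  set a := mean _ in a0.
  have a2 : 0 < a ^+ 2 by rewrite lt_neqAle sqr_ge0 andbT eq_sym expf_eq0.
  apply/cvgrPdist_le => e e0.
  have := small phi phi_itv _ (mulr_gt0 e0 a2).
  apply: filterS => N VN; rewrite sub0r normrN.
  have /andP[S0 SV] := legendre_sum_bound d_ge1 phi (sP n.+1) (P1 n.+1) (@X_sphere N)
    (legendre_ortho d_ge1 LP (n := n.+1)).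
  rewrite pmulr_rge0// in S0.
  rewrite ger0_norm ?mulr_ge0 ?invr_ge0//.
  have Sb : \sum_(i < N) \sum_(j < N) (P n.+1).[dotp (X N i) (X N j)] <= e * N%:R.
    by rewrite -(ler_pM2l a2) (le_trans SV)// (le_trans VN)// mulrAC mulrC mulrA.
  (* At [N = 0] the quotient is zero because [0^-1 = 0]. *)
  have [->|N0] := posnP N; first by rewrite invr0 mul0r ltW.
  by rewrite mulrC ler_pdivrMr ?ltr0n.
move=> z phi0 Sz phi0_itv; rewrite surface_cap//; set c := cos phi0.
apply/cvgrPdist_le => e e0.
have e2 : 0 < e / 2 by rewrite divr_gt0.
have [delta d0 [up low]] := cap_mean_continuous d_ge1 c e2.
(* A test cap this small moves the height over [z] by at most [delta], as [dotp_chord] requires; the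
   bound [2^-1] keeps its radius below [pi / 2]. *)
pose b := Num.max (1 - delta ^+ 2 / 2) 2^-1.
have b1 : b < 1.
  by rewrite /b gt_max; apply/andP; split; [have := exprn_gt0 2 d0; lra|lra].
have b0 : 0 < b by rewrite /b lt_max; apply/orP; right; lra.
have bd : 1 - delta ^+ 2 / 2 <= b by rewrite /b le_max lexx.
have [phi_itv cK] := acos_itv (introT andP (conj b0 b1)).
set phi := acos b in phi_itv cK.
have a0 : 0 < cap_mean d (cos phi) by rewrite cK; exact: cap_gt0.
set a := cap_mean d (cos phi) in a0.
near=> N.
have N1 : (0 < N)%N by near: N; exists 1%N.
have N0 : (0 : R) < N%:R by rewrite ltr0n.
(* After division by [a N] this error is [e / 2], the other half being spent on the change of cap.
   For [N >= 1], [tau ^+ 2] is at least [(a * (e / 2)) ^+ 2 * N%:R], which eventually exceeds the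
   variance. *)
pose tau := a * (e / 2) * N%:R.
have tau0 : 0 < tau by rewrite !mulr_gt0.
have Vt : number_variance (X N) phi <= tau ^+ 2.
  apply: (@le_trans _ _ ((a * (e / 2)) ^+ 2 * N%:R)).
    by near: N; apply: small => //; rewrite exprn_gt0// mulr_gt0.
  have NN : (N%:R : R) <= N%:R ^+ 2 by rewrite expr2 ler_peMl ?ler1n// ltW.
  by rewrite /tau [leRHS]exprMn; apply: ler_wpM2l => //; exact: sqr_ge0.
have [|h1 h2] := @count_bounds R d d_ge1 N (X N) phi tau c (c - delta) (c + delta) z
  (@X_sphere N) Sz tau0 Vt.
  move=> i y Sy; rewrite cK => iy; split.
    have := dotp_chord (@X_sphere N i) Sy Sz d0 bd iy; lra.
  have := dotp_chord Sy (@X_sphere N i) Sz d0 bd; rewrite dotpC => /(_ iy); lra.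
rewrite npoints_cap// -/c; set C := \sum_(i < N) _.
rewrite -/C -/a in h1 h2.
have {}h1 : C - N%:R * cap_mean d (c - delta) <= e / 2 * N%:R.
  by rewrite -(ler_pM2l a0) mulrA.
have {}h2 : - (e / 2 * N%:R) <= C - N%:R * cap_mean d (c + delta).
  by rewrite -(ler_pM2l a0) mulrN mulrA.
have r1 : N%:R^-1 * C <= e / 2 + cap_mean d (c - delta).
  by rewrite mulrC ler_pdivrMr// mulrDl -lerBlDr [cap_mean _ _ * _]mulrC.
have r2 : cap_mean d (c + delta) - e / 2 <= N%:R^-1 * C.
  by rewrite [leRHS]mulrC ler_pdivlMr// mulrBl [cap_mean _ _ * _]mulrC; lra.
by rewrite ler_norml; apply/andP; split; lra.
Unshelve. all: by end_near.
Qed.
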